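(* Let $n \in \mathbb{N}$ and let $B\subseteq \mathbb{R}^n$ be a maximal lattice-free polytope with the unique-lifting property such that $B$ is a pyramid whose base contains exactly one integral point in its relative interior. Then $B$ is a simplex.
   Context: A polytope $P$ is a pyramid if $P=\operatorname{conv}(P_0\cup\{a\})$ for some polytope $P_0$ (the base) and some point $a\notin\operatorname{aff}(P_0)$ (the apex). Integral points are points of $\mathbb{Z}^n$. A set $B\subseteq\mathbb{R}^n$ is lattice-free if it is $n$-dimensional, closed, convex and $\operatorname{int}(B)\cap\mathbb{Z}^n=\emptyset$; it is maximal lattice-free if it is inclusion-maximal among lattice-free sets. For $f\in\mathbb{R}^n\setminus\mathbb{Z}^n$, a cut-generating pair for $f$ is a pair of nonnegative functions $\psi,\pi:\mathbb{R}^n\to\mathbb{R}$ such that for all integers $k,\ell\ge 0$, not both zero, and all matrices $R\in\mathbb{R}^{n\times k}$ with columns $r_1,\dots,r_k$ and $P\in\mathbb{R}^{n\times \ell}$ with columns $p_1,\dots,p_\ell$, the inequality $\sum_{i=1}^k\psi(r_i)s_i+\sum_{j=1}^\ell\pi(p_j)y_j\ge 1$ holds for every $(s,y)\in\mathbb{R}_+^k\times\mathbb{Z}_+^\ell$ with $f+Rs+Py\in\mathbb{Z}^n$. In this case $\pi$ is called a lifting of $\psi$. A minimal lifting is a lifting $\pi$ of $\psi$ such that no other, distinct lifting $\pi'$ of $\psi$ satisfies $\pi'\le\pi$ pointwise. For $f\in\operatorname{int}(B)$, the gauge function of $B-f$ is $\phi_{B-f}(r)=\inf\{\rho>0: r/\rho\in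 B-f\}$. A maximal lattice-free polytope $B$ has the unique-lifting property if for every (equivalently, for some) $f\in\operatorname{int}(B)$ the function $\phi_{B-f}$ has exactly one minimal lifting. Known characterization from earlier literature, used by the paper as a working description: for a maximal lattice-free polytope $B$ and $f\in\operatorname{int}(B)$, $\phi_{B-f}$ has exactly one minimal lifting if and only if $R(B,f)+\mathbb{Z}^n=\mathbb{R}^n$, where $R(B,f)=\bigcup_{F}\bigcup_{z\in F\cap\mathbb{Z}^n}\bigl[\operatorname{conv}(\{f\}\cup F)\cap(z+f-\operatorname{conv}(\{f\}\cup F))\bigr]$, with $F$ ranging over all faces of $B$ other than $\emptyset$ and $B$. *)

(* Defs.v *)
From HB Require Import structures.
From mathcomp Require Import all_boot all_order all_algebra.
From mathcomp Require Import all_classical all_reals all_analysis.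

Set Implicit Arguments.
Unset Strict Implicit.
Unset Printing Implicit Defensive.

Import Order.TTheory GRing.Theory Num.Theory.
Import numFieldNormedType.Exports.

Local Open Scope classical_set_scope.
Local Open Scope ring_scope.

Section ConvexGeometry.
Variables (R : realType) (n : nat).
Local Notation V := 'cV[R]_n.
Implicit Types A B P : set V.

Definition conv_hull A : set V := smallest (@convex_set R V) A.

Definition affine_set A :=
  forall (x y : V) (t : R), A x -> A y -> A ((1 - t) *: x + t *: y).

Definition aff_hull A : set V := smallest affine_set A.

(* Interior with respect to the subspace topology of the affine hull. *)
Definition relint A : set V :=
  [set x | A x /\ \forall y \near x, aff_hull A y -> A y].

Definition polytope P := exists2 A, finite_set A & P = conv_hull A.

Definition pyramid P (base : set V) (apex : V) :=
  [/\ polytope base, ~ aff_hull base apex & P = conv_hull (base `|` [set apex])].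

Definition affinely_independent k (v : 'I_k -> V) :=
  forall c : 'I_k -> R,
    \sum_(i < k) c i *: v i = 0 -> \sum_(i < k) c i = 0 -> forall i, c i = 0.

Definition simplex P :=
  exists k (v : 'I_k.+1 -> V), affinely_independent v /\ P = conv_hull (range v).

Definition integral_point : set V := [set x | x \is a mxOver Num.int].

(* [aff_hull B = setT] expresses that B is n-dimensional. *)
Definition lattice_free B :=
  [/\ aff_hull B = setT, closed B, convex_set B & B° `&` integral_point = set0].

Definition maximal_lattice_free B :=
  lattice_free B /\ forall C, lattice_free C -> B `<=` C -> C = B.

Definition gauge_function B (f r : V) : R :=
  inf [set rho : R | 0 < rho /\ [set b - f | b in B] (rho^-1 *: r)].

Definition cut_generating_pair (f : V) (psi pi : V -> R) :=
  [/\ forall r, 0 <= psi r, forall p, 0 <= pi p &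
    forall (k l : nat) (M : 'M[R]_(n, k)) (P : 'M[R]_(n, l))
      (s : 'cV[R]_k) (y : 'cV[R]_l),
      (0 < k + l)%N ->
      (forall i, 0 <= s i 0) -> (forall j, y j 0 \is a Num.nat) ->
      integral_point (f + M *m s + P *m y) ->
      1 <= \sum_(i < k) psi (col i M) * s i 0
           + \sum_(j < l) pi (col j P) * y j 0].

Definition minimal_lifting (f : V) (psi pi : V -> R) :=
  cut_generating_pair f psi pi /\
  forall pi' : V -> R, cut_generating_pair f psi pi' ->
    (forall p, pi' p <= pi p) -> pi' = pi.

(* If B is lattice-free, every f in B° is automatically non-integral. *)
Definition unique_lifting B :=
  forall f : V, B° f -> exists! pi, minimal_lifting f (gauge_function B f) pi.

End ConvexGeometry.

(* Main.v *)
Require Import Defs.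
From HB Require Import structures.
From mathcomp Require Import all_boot all_order all_algebra.
From mathcomp Require Import all_classical all_reals all_analysis.
From mathcomp Require Import zify ring lra.

Set Implicit Arguments.
Unset Strict Implicit.
Unset Printing Implicit Defensive.

Import Order.TTheory GRing.Theory Num.Theory.
Import numFieldNormedType.Exports.

Local Open Scope classical_set_scope.
Local Open Scope ring_scope.

(** Let [a] be the apex of the pyramid [B], [z0] the integral point in the relative
interior of the base and [s = z0 - a]. Then [B] is the part below height 1 of a
cone [a + C], where [C] is given by one functional [u i] per facet through the apex
([pyramid_description]), normalized by [dot (u i) s = 1], and the height [h] is 1 on
the base. It suffices to show that the [u i] are linearly independent: as [C] is
pointed, it is then spanned by the dual basis, and [B] is a simplex
([pyramid_simplex]).

Two facts about the lattice are used. First, since [B] is lattice-free and [z0] is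
the only integral point in the relative interior of its base, every nonzero
integral [w] with all [dot (u i) w > -1] has positive height
([lattice_height_gt0]). Second, unique lifting implies that for [f] in the interior
of [B], with gauge [psi], and generic [p] there are integral [w] and [w'] with
[psi (p + w) + psi (- f - p + w')] as close to 1 as desired
([unique_lifting_pair]): otherwise the gauge could be lowered at [p] and at
[- f - p] separately, giving two liftings whose values at these two points add up to
less than 1, and by Zorn's lemma the unique minimal lifting would lie below both of
them. For [f] tending to the apex this says that the integral translates of the
intersection of [a + C] with [z0 - C] cover a neighbourhood of the apex
([cover_near_apex]).

Now consider a point just outside the cone, beyond its [i]-th facet. The translation
that moves it back into this intersection is an integral vector [y i] with
[dot (u i) (y i) = 1] and [0 <= dot (u k) (y i) < 1] for [k != i]
([facet_lattice_vector]). If [dot (u k) (y i) > 0] for some [k != i], then all facet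
functionals exceed -1 on [y i - y k], so [y i] is higher than [y k]. Ordering the
facets by the height of [y i] thus makes the matrix of the [dot (u k) (y i)]
unitriangular, which proves the independence ([facet_functionals_free]). *)

(** * Integral points *)

Section IntegralPoints.
Variables (R : realType) (n : nat).
Local Notation V := 'cV[R]_n.
Local Notation Zn := (@integral_point R n).
Implicit Types x y w : V.

Lemma integral_pointP x : Zn x <-> forall i, x i 0 \is a Num.int.
Proof.
split=> [/mxOverP H i|H]; first exact: H.
by apply/mxOverP => i j; rewrite ord1.
Qed.

Lemma integral_pointD x y : Zn x -> Zn y -> Zn (x + y).
Proof.
move=> /integral_pointP xZ /integral_pointP yZ.
by apply/integral_pointP => i; rewrite mxE rpredD.
Qed.

Lemma integral_pointN x : Zn x -> Zn (- x).
Proof. by move=> /integral_pointP xZ; apply/integral_pointP => i; rewrite mxE rpredN. Qed.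

Lemma integral_pointB x y : Zn x -> Zn y -> Zn (x - y).
Proof. by move=> xZ yZ; apply: integral_pointD => //; apply: integral_pointN. Qed.

Lemma integral_point0 : Zn 0.
Proof. by apply/integral_pointP => i; rewrite mxE rpred0. Qed.

Lemma mx_entry_le_norm x i : `|x i 0| <= `|x|.
Proof.
rewrite [leRHS]/Num.norm /= mx_normrE.
by apply/bigmax_geP; right => /=; exists (i, 0).
Qed.

Lemma finite_integral (K : R) : finite_set [set w | Zn w /\ `|w| <= K].
Proof.
pose N := Num.bound `|K|.
pose f (g : {ffun 'I_n -> 'I_(N + N).+1}) : V := \col_i ((g i : nat)%:R - N%:R).
apply: (@sub_finite_set _ _ (f @` setT)); last exact: finite_image.
move=> w [/= /integral_pointP wZ wK].
have bnd i : exists j : 'I_(N + N).+1, w i 0 = (j : nat)%:R - N%:R.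
  have /intrP [m wm] := wZ i.
  have : `|w i 0| <= N%:R.
    apply: le_trans (mx_entry_le_norm _ _) _; apply: le_trans wK _.
    apply: ltW; apply: le_lt_trans (ler_norm _) _.
    exact: (archi_boundP (normr_ge0 K)).
  rewrite wm -intr_norm -[N%:R]/((N%:Z)%:~R) ler_int => mN.
  pose k := m + N%:Z.
  have k0 : 0 <= k by rewrite /k; lia.
  have klt : (absz k < (N + N).+1)%N by rewrite /k; lia.
  exists (Ordinal klt) => /=.
  have -> : (absz k)%:R = k%:~R :> R by rewrite -{2}(gez0_abs k0).
  by rewrite intrD -[N%:~R]/(N%:R : R) addrK.
have [F wF] := choice bnd.
exists [ffun i => F i] => //.
by apply/colP => i; rewrite mxE ffunE.
Qed.

End IntegralPoints.

(** This is what replaces limits: along a bounded family of integral points, a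
strict inequality that is violated is violated by a fixed amount, so a small
enough error in an inequality can be dropped. *)
Lemma finite_gap (R : realType) T (A : set T) (phi : T -> R) : finite_set A ->
  exists2 e, 0 < e & forall x, A x -> 0 < phi x -> e <= phi x.
Proof.
move=> /(finite_image phi) /finite_seqP [s As].
have [e e0 He] : exists2 e, 0 < e & forall r, r \in s -> 0 < r -> e <= r.
  elim: s {As} => [|r s [e e0 He]]; first by exists 1.
  have [r0|r0] := ltP 0 r.
    exists (Num.min e r); first by rewrite lt_min e0.
    move=> t; rewrite inE => /orP [/eqP -> _|ts t0]; first by rewrite ge_min lexx orbT.
    by rewrite ge_min He.
  exists e => // t; rewrite inE => /orP [/eqP ->|]; last exact: He.
  by rewrite ltNge r0.
exists e => // x Ax; apply: He.
have : (phi @` A) (phi x) by exists x.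
by rewrite As.
Qed.

(** * Liftings of sublinear functions *)

Section Lifting.
Variables (R : realType) (n : nat).
Local Notation V := 'cV[R]_n.
Local Notation Zn := (@integral_point R n).
Variables (f : V) (psi : V -> R).

(** Zorn's lemma. The infimum of a chain of liftings is a lifting because each
instance of the defining inequality involves finitely many values of the
lifting, and these are nearly attained by one member of the chain. *)
Lemma minimal_lifting_below (pi0 : V -> R) : cut_generating_pair f psi pi0 ->
  exists2 pi, minimal_lifting f psi pi & forall p, pi p <= pi0 p.
Proof.
move=> cg0; pose T := {xi | cut_generating_pair f psi xi /\ forall p, xi p <= pi0 p}.
have t0 : T by exists pi0.
have mkT (xi : V -> R) : cut_generating_pair f psi xi ->
    (forall p, xi p <= pi0 p) -> exists2 t : T, forall p, sval t p = xi p & True.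
  by move=> cg le; exists (exist _ xi (conj cg le)).
pose ge (s t : T) := `[< forall p, sval t p <= sval s p >].
have [||||t tmax] := @Zorn T ge.
- by move=> t; apply/asboolP => p.
- move=> r s t /asboolP rs /asboolP st; apply/asboolP => p.
  exact: le_trans (st p) (rs p).
- move=> [s Ps] [t Pt] /asboolP /= st /asboolP /= ts; apply: eq_exist.
  by apply/funext => p; apply/eqP; rewrite eq_le st ts.
- move=> A Atot; have [[a Aa]|/forallNP A0] := pselect (exists a, A a); last first.
    by exists t0 => s /A0.
  pose S p := [set sval s p | s in A].
  have Slb p : has_lbound (S p).
    by exists 0 => _ [[pi [[_ pi_ge0 _] _]] _ <-] /=; apply: pi_ge0.
  have Sinf p : has_inf (S p) by split=> //; exists (sval a p), a.
  have infle p s : A s -> inf (S p) <= sval s p by move=> As; apply: ge_inf => //; exists s.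
  have inf0 p : 0 <= inf (S p).
    apply: lb_le_inf; first by exists (sval a p), a.
    by move=> _ [[pi [[_ pi_ge0 _] _]] _ <-] /=; apply: pi_ge0.
  have psi0 : forall r, 0 <= psi r by case: cg0.
  (* One member of the chain is simultaneously close to the infimum at finitely many
     points, since the chain is totally ordered. *)
  have common (l : nat) (q : 'I_l -> V) e : 0 < e ->
      exists2 s, A s & forall j, sval s (q j) <= inf (S (q j)) + e.
    move=> e0; have {}q' : forall j, j \in enum 'I_l -> True by [].
    suff [s As H] : exists2 s, A s &
        forall j, j \in enum 'I_l -> sval s (q j) <= inf (S (q j)) + e.
      by exists s => // j; apply: H; rewrite mem_enum.
    elim: (enum 'I_l) {q'} => [|j js [s As Hs]]; first by exists a.
    have [_ [t At <-] lt_t] := inf_adherent e0 (Sinf (q j)).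
    have [/asboolP st|/asboolP ts] := Atot _ _ As At.
      exists t => // i; rewrite inE => /orP [/eqP ->|/Hs]; first exact: ltW.
      exact: le_trans (st _).
    exists s => // i; rewrite inE => /orP [/eqP ->|/Hs //].
    by apply: le_trans (ts _) _; exact: ltW.
  suff cginf : cut_generating_pair f psi (fun p => inf (S p)).
    have [|t tE _] := mkT _ cginf; last first.
      by exists t => s As; apply/asboolP => p; rewrite tE; apply: infle.
    by move=> p; apply: le_trans (infle p _ Aa) _; case: (svalP a).
  split=> // k l M P s y kl s0 yN fZ; rewrite leNgt; apply/negP => lt1.
  set X := \sum_(i < k) _ in lt1; set Y := \sum_(j < l) _ in lt1.
  pose W := \sum_(j < l) y j 0.
  have y0 j : 0 <= y j 0 by have /natrP [m ->] := yN j; rewrite ler0n.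
  have W0 : 0 <= W by apply: sumr_ge0.
  have e0 : 0 < (1 - (X + Y)) / (2 * (W + 1)) by apply: divr_gt0; lra.
  set e := _ / _ in e0.
  have [t At Ht] := common l (fun j => col j P) e e0.
  have [[_ _ cgt] _] := svalP t.
  have := cgt k l M P s y kl s0 yN fZ.
  apply/negP; rewrite -ltNge.
  have le1 : \sum_(j < l) sval t (col j P) * y j 0 <= Y + e * W.
    rewrite /Y /W mulr_sumr -big_split /=; apply: ler_sum => j _.
    by rewrite -mulrDl ler_wpM2r.
  have : e * W < 1 - (X + Y).
    have -> : 1 - (X + Y) = e * (2 * (W + 1)).
      by rewrite /e divfK //; lra.
    by rewrite ltr_pM2l //; lra.
  by rewrite -/X; lra.
exists (sval t); last by case: (svalP t).
split=> [|pi' cg' le']; first by case: (svalP t).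
have [p|t' t'E _] := mkT _ cg'; first by apply: le_trans (le' p) _; case: (svalP t).
have <- : t' = t by apply: tmax; apply/asboolP => p; rewrite t'E.
by apply/funext => p; rewrite t'E.
Qed.

(** From here on [psi] is any sublinear function with the properties of the
gauge of a bounded lattice-free set. *)
Hypothesis psi_ge0 : forall x, 0 <= psi x.
Hypothesis psiD : forall x y, psi (x + y) <= psi x + psi y.
Hypothesis psiZ : forall t x, 0 <= t -> psi (t *: x) <= psi x * t.
Hypothesis psi_integral : forall z, Zn z -> 1 <= psi (z - f).
Variable K : R.
Hypothesis psi_norm : forall x, `|x| <= K * psi x.

Lemma sublinear_sum k (r : 'I_k -> V) (s : 'I_k -> R) (Q : pred 'I_k) :
  (forall i, 0 <= s i) ->
  psi (\sum_(i | Q i) s i *: r i) <= \sum_(i | Q i) psi (r i) * s i.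
Proof.
move=> s0; elim/big_ind2: _ => [|x1 y1 x2 y2 le1 le2|i _].
- by have := psiZ 0 (lexx 0); rewrite scale0r mulr0.
- by apply: le_trans (psiD _ _) _; apply: lerD.
- exact: psiZ.
Qed.

Lemma mulmx_col k (M : 'M[R]_(n, k)) (s : 'cV[R]_k) :
  M *m s = \sum_i s i 0 *: col i M.
Proof.
by apply/colP => i; rewrite mxE summxE; apply: eq_bigr => j _; rewrite !mxE mulrC.
Qed.

(** Lowering [psi] at the single point [p] costs nothing as long as all
inequalities in which [p] is used some number [N] of times survive: the
remaining terms collapse into a single value of [psi] by sublinearity. *)
Lemma lifting_at_point p (c : R) : 0 <= c ->
  (forall (N : nat) z, (0 < N)%N -> Zn z -> 1 <= N%:R * c + psi (z - f - p *+ N)) ->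
  cut_generating_pair f psi (fun x => if x == p then c else psi x).
Proof.
move=> c0 Hc; split=> // [x|k l M P s y _ s0 yN]; first by case: ifP.
set z := f + M *m s + P *m y => zZ.
have y0 j : 0 <= y j 0 by have /natrP [m ->] := yN j; rewrite ler0n.
have /natrP [N HN] : \sum_(j < l | col j P == p) y j 0 \is a Num.nat by apply: rpred_sum.
have -> : \sum_(j < l) (if col j P == p then c else psi (col j P)) * y j 0 =
    N%:R * c + \sum_(j < l | col j P != p) psi (col j P) * y j 0.
  rewrite (bigID (fun j => col j P == p)) /= -HN mulr_suml; congr (_ + _).
    by apply: eq_bigr => j ->; rewrite mulrC.
  by apply: eq_bigr => j /negbTE ->.
have Pyp : P *m y = p *+ N + \sum_(j < l | col j P != p) y j 0 *: col j P.
  rewrite mulmx_col (bigID (fun j => col j P == p)) /=; congr (_ + _).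
  by rewrite -scaler_nat -HN scaler_suml; apply: eq_bigr => j /eqP ->.
have le1 := sublinear_sum (fun i => col i M) xpredT s0.
have le2 := sublinear_sum (fun j => col j P) (fun j => col j P != p) y0.
have le3 := psiD (\sum_i s i 0 *: col i M) (\sum_(j < l | col j P != p) y j 0 *: col j P).
have zE : z - f - p *+ N = \sum_i s i 0 *: col i M + \sum_(j < l | col j P != p) y j 0 *: col j P.
  by rewrite /z Pyp mulmx_col; apply/colP => i; rewrite !mxE; ring.
suff : 1 <= N%:R * c + psi (z - f - p *+ N) by rewrite zE; lra.
have [->|N0] := posnP N; last exact: Hc.
by rewrite mul0r add0r mulr0n subr0; apply: psi_integral.
Qed.

Let valid p (c : R) := 0 <= c /\
  forall (N : nat) z, (0 < N)%N -> Zn z -> 1 <= N%:R * c + psi (z - f - p *+ N).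

(** The unique minimal lifting lies below both one-point modifications of [psi],
and since [f + p + q = 0] is integral its values at [p] and [q] add up to at
least 1. *)
Lemma unique_lifting_coefficients p q c d :
  (exists! pi, minimal_lifting f psi pi) -> p + q = - f ->
  valid p c -> valid q d -> 1 <= c + d.
Proof.
move=> [pi [[cgpi _] piU]] pq [c0 cP] [d0 dP].
have [pi1 /piU <- /(_ p)] := minimal_lifting_below (lifting_at_point c0 cP).
rewrite eqxx => pip.
have [pi2 /piU <- /(_ q)] := minimal_lifting_below (lifting_at_point d0 dP).
rewrite eqxx => piq.
apply: le_trans (lerD pip piq); have [_ _ cg] := cgpi.
have := cg 0%N (1 + 1)%N 0 (row_mx p q) 0 (const_mx 1).
rewrite big_ord0 add0r big_ord_recl big_ord1 !mxE !mulr1.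
have -> : col ord0 (row_mx p q) = p.
  apply/colP => i; rewrite !mxE; case: splitP => [j _|[j jlt] /=]; first by rewrite ord1.
  by [].
have -> : col (lift ord0 ord0) (row_mx p q) = q.
  apply/colP => i; rewrite !mxE; case: splitP => [[[] ] //|j _]; by rewrite ord1.
apply=> //; first by case.
  by move=> j; rewrite mxE rpred1.
have -> : row_mx p q *m const_mx 1 = p + q.
  rewrite -(vsubmxK (const_mx 1)) mul_row_col.
  by apply/colP => i; rewrite !mxE !big_ord1 !mxE !mulr1.
by rewrite mulmx0 addr0 pq subrr; apply: integral_point0.
Qed.

(** The periodization of [psi], the trivial lifting of the literature. *)
Let g x := inf [set psi (x + w) | w in Zn].

Let g_le x w : Zn w -> g x <= psi (x + w).
Proof.
by move=> wZ; apply: ge_inf; [exists 0 => _ [v _ <-]; apply: psi_ge0|exists w].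
Qed.

Let g_ge x c : (forall w, Zn w -> c <= psi (x + w)) -> c <= g x.
Proof.
move=> H; apply: lb_le_inf; first by exists (psi (x + 0)), 0 => //; apply: integral_point0.
by move=> _ [w wZ <-]; apply: H.
Qed.

Let gD x y : g (x + y) <= g x + g y.
Proof.
rewrite -lerBlDr; apply: g_ge => w wZ; rewrite lerBlDr -lerBlDl.
apply: g_ge => v vZ; rewrite lerBlDl.
apply: le_trans (psiD _ _); rewrite addrACA; apply: g_le; exact: integral_pointD.
Qed.

Let gMn x p N : g (x + p *+ N) <= g x + N%:R * g p.
Proof.
elim: N => [|N IH]; first by rewrite mulr0n addr0 mul0r addr0.
rewrite mulrSr addrA; apply: le_trans (gD _ _) _.
by rewrite -natr1 mulrDl mul1r addrA lerD2r.
Qed.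

Let g_gt0 x : ~ Zn x -> 0 < g x.
Proof.
move=> xZ.
have [e e0 He] := finite_gap (fun w => `|x + w|) (@finite_integral R n (1 + `|x|)).
have K0 : 0 < Num.max K 1 by rewrite lt_max ltr01 orbT.
have m0 : 0 < Num.min e 1 by rewrite lt_min e0 ltr01.
apply: lt_le_trans (divr_gt0 m0 K0) _.
apply: g_ge => w wZ; rewrite ler_pdivrMr //.
apply: (@le_trans _ _ `|x + w|); last first.
  apply: le_trans (psi_norm _) _; rewrite mulrC ler_wpM2l //.
  by rewrite le_max lexx.
rewrite ge_min; have [wx|wx] := leP `|w| (1 + `|x|).
  rewrite He // normr_gt0; apply/eqP => xw0; apply: xZ.
  have -> : x = - w by rewrite -[x](addrK w) xw0 sub0r.
  exact: integral_pointN.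
apply/orP; right; have := ler_normB (x + w) x.
by rewrite addrC addKr => ?; lra.
Qed.

(** If [g p + g q > 1] and [g p <= 1 / 2], then [g p] can be decreased a little:
[N] copies of [p] need [N * c + g (- f - p *+ N) >= 1], where subadditivity
leaves the slack [delta] for every [N], and only the finitely many
[N <= m] for which [N * c] is not already large matter. At [q] the coefficient
[1 - g p >= 1 / 2] is tight for one copy and trivial for more. *)
Let small_coefficient p q delta : p + q = - f -> 0 < g p -> g p <= 1 / 2 ->
  0 < delta -> 1 + delta <= g p + g q ->
  exists c d, [/\ valid p c, valid q d & c + d < 1].
Proof.
move=> pq gp0 gp2 d0 gpq; pose m := Num.bound ((1 + delta) / g p).
have fpq z : z - f - q = p + z by rewrite -pq; apply/colP => i; rewrite !mxE; ring.
have mg : 1 + delta <= m%:R * g p.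
  rewrite -ler_pdivrMr //; apply/ltW/archi_boundP/divr_ge0 => //; lra.
have m0 : 0 < m%:R :> R.
  by rewrite ltNge; apply/negP => m0; have := mulr_le0_ge0 m0 (ltW gp0); lra.
have dm : m%:R * (delta / m%:R) = delta by rewrite mulrC divfK // gt_eqF.
have dm0 : 0 < delta / m%:R by apply: divr_gt0.
have c0 : 0 <= g p - delta / m%:R.
  by rewrite subr_ge0 ler_pdivrMr // mulrC; lra.
exists (g p - delta / m%:R), (1 - g p); split; last by lra.
- split=> // N z N0 zZ.
  have := psi_ge0 (z - f - p *+ N); rewrite mulrBr.
  have [Nm|mN] := leP N m; last first.
    have : m%:R * (g p - delta / m%:R) <= N%:R * (g p - delta / m%:R).
      by apply: ler_wpM2r => //; rewrite ler_nat ltnW.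
    by rewrite !mulrBr dm; lra.
  have : N%:R * (delta / m%:R) <= delta by rewrite -{2}dm ler_wpM2r ?ler_nat // ltW.
  have := gMn (- f - p *+ N) p N.-1.
  have -> : - f - p *+ N + p *+ N.-1 = q.
    by rewrite -pq -{1}(prednK N0) mulrSr; apply/colP => i; rewrite !mxE; ring.
  have /g_le : Zn z by [].
  move=> /(_ (- f - p *+ N)).
  have -> : - f - p *+ N + z = z - f - p *+ N by apply/colP => i; rewrite !mxE; ring.
  have -> : N%:R = N.-1%:R + 1 :> R by rewrite natr1 prednK.
  by rewrite mulrDl mul1r; lra.
- split=> [|N z N0 zZ]; first lra.
  have [N1|N2] := leqP N 1.
    have -> : N = 1%N by apply/eqP; rewrite eqn_leq N1.
    by rewrite mulr1n mul1r fpq; have := g_le p zZ; lra.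
  have : 2 * (1 / 2) <= N%:R * (1 - g p).
    by apply: ler_pM; rewrite ?(ler_nat _ 2) //; lra.
  by have := psi_ge0 (z - f - q *+ N); lra.
Qed.

(** Unique lifting forces [g p + g q <= 1]. Otherwise one finds admissible
coefficients of sum less than 1, by [small_coefficient] if [g p] or [g q] is at
most [1 / 2], and otherwise by taking both of them just below [1 / 2]; the latter
works for two copies of [p] because [q - p] is not integral, hence
[g (q - p) > 0]. *)
Lemma unique_lifting_pair p q tol : (exists! pi, minimal_lifting f psi pi) ->
  p + q = - f -> ~ Zn p -> ~ Zn q -> ~ Zn (q - p) -> 0 < tol ->
  exists w w', [/\ Zn w, Zn w' & psi (p + w) + psi (q + w') < 1 + tol].
Proof.
move=> U pq pZ qZ qpZ tol0; apply: contrapT => H.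
have gpq : 1 + tol <= g p + g q.
  rewrite -lerBlDr; apply: g_ge => w wZ; rewrite lerBlDr -lerBlDl.
  apply: g_ge => v vZ; rewrite lerBlDl leNgt; apply/negP => lt1.
  by apply: H; exists w, v.
suff [c [d [vc vd cd]]] : exists c d, [/\ valid p c, valid q d & c + d < 1].
  by have := unique_lifting_coefficients U pq vc vd; lra.
have [gp|gp] := leP (g p) (1 / 2).
  exact: small_coefficient pq (g_gt0 pZ) gp tol0 gpq.
have [gq|gq] := leP (g q) (1 / 2).
  have [||d [c [vd vc dc]]] := @small_coefficient q p tol _ (g_gt0 qZ) gq tol0.
  - by rewrite addrC.
  - by rewrite [leRHS]addrC.
  - by exists c, d; split=> //; rewrite addrC.
have gqp := g_gt0 qpZ.
have gpq0 : 0 < g (p - q).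
  by apply: g_gt0 => /integral_pointN; rewrite opprB.
(* Three or more copies are covered by 1 / 3, one copy by [1 - g b], and two copies
   by [g (b - a)]. *)
have main a b c : a + b = - f -> 1 / 3 <= c -> 1 - g b <= c ->
    1 - g (b - a) <= 2 * c -> valid a c.
  move=> ab c3 cb cba; split=> [|N z N0 zZ]; first lra.
  have := psi_ge0 (z - f - a *+ N).
  case: N N0 => [//|[|[|N]]] _.
  - have := g_le b zZ; rewrite mulr1n mul1r.
    have -> : z - f - a = b + z by rewrite -ab; apply/colP => i; rewrite !mxE; ring.
    by lra.
  - have := g_le (b - a) zZ; rewrite mulr2n.
    have -> : z - f - (a + a) = b - a + z by rewrite -ab; apply/colP => i; rewrite !mxE; ring.
    by lra.
  - have : 3 * (1 / 3) <= N.+3%:R * c by apply: ler_pM; rewrite ?(ler_nat _ 3) //; lra.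
    by lra.
pose c := Num.max (1 / 3) (Num.max (1 - g q) ((1 - g (q - p)) / 2)).
pose d := Num.max (1 / 3) (Num.max (1 - g p) ((1 - g (p - q)) / 2)).
have [c1 [c2 [c3 c4]]] : 1 / 3 <= c /\ 1 - g q <= c /\ (1 - g (q - p)) / 2 <= c /\ c < 1 / 2.
  by rewrite /c !le_max !gt_max !lexx !orbT; do 3!split=> //; apply/and3P; split; lra.
have [d1 [d2 [d3 d4]]] : 1 / 3 <= d /\ 1 - g p <= d /\ (1 - g (p - q)) / 2 <= d /\ d < 1 / 2.
  by rewrite /d !le_max !gt_max !lexx !orbT; do 3!split=> //; apply/and3P; split; lra.
exists c, d; split; last by lra.
- by apply: (main p q) => //; lra.
- by apply: (main q p) => //; [rewrite addrC|lra].
Qed.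

End Lifting.

(** * Convex sets *)

Section Convexity.
Variables (R : realType) (n : nat).
Local Notation V := 'cV[R]_n.
Local Notation Zn := (@integral_point R n).
Implicit Types A B : set V.

Lemma convex_setP A : @convex_set R V A <->
  forall x y t, A x -> A y -> 0 <= t -> t <= 1 -> A (t *: x + (1 - t) *: y).
Proof.
split=> [cA x y t Ax Ay t0 t1|cA x y t].
  by have := cA x y (Itv01 t0 t1); rewrite !inE => /(_ Ax Ay).
by rewrite !inE => Ax Ay; exact: (cA x y t%:num).
Qed.

Lemma conv_hull_convex A : @convex_set R V (conv_hull A).
Proof.
apply/convex_setP => x y t Ax Ay t0 t1 X [cX AX].
by apply: (iffLR (convex_setP X) cX) => //; [apply: Ax|apply: Ay].
Qed.

Lemma interior_ballP B f : B° f <-> exists2 e : R, 0 < e & forall y, `|f - y| < e -> B y.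
Proof.
split=> [/(iffLR (nbhs_ballP _ _)) [e /= e0 He]|[e e0 He]].
  by exists e => // y lty; apply: He; rewrite -ball_normE.
by apply/nbhs_ballP; exists e => //= y; rewrite -ball_normE => /He.
Qed.

(** The ball around [f] contained in [B], shrunk by the factor [t] towards [b]. *)
Lemma convex_interior B f b t : @convex_set R V B -> B° f -> B b ->
  0 < t -> t <= 1 -> B° (t *: f + (1 - t) *: b).
Proof.
move=> /convex_setP cB /interior_ballP [e e0 He] Bb t0 t1.
apply/interior_ballP; exists (t * e); first exact: mulr_gt0.
move=> y lty.
have -> : y = t *: (f - t^-1 *: (t *: f + (1 - t) *: b - y)) + (1 - t) *: b.
  rewrite scalerBr scalerA divff ?gt_eqF // scale1r.
  by apply/colP => i; rewrite !mxE; ring.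
apply: cB => //; last exact: ltW.
by apply: He; rewrite opprB addrC subrK normrZ gtr0_norm ?invr_gt0 // ltr_pdivrMl.
Qed.

End Convexity.

(** * Gauge functions *)

Section Gauge.
Variables (R : realType) (n : nat).
Local Notation V := 'cV[R]_n.
Local Notation Zn := (@integral_point R n).
Variables (B : set V) (f : V) (K : R).
Hypothesis B_convex : @convex_set R V B.
Hypothesis f_int : B° f.
Hypothesis B_free : B° `&` Zn = set0.
Hypothesis B_bounded : forall b, B b -> `|b - f| <= K.
Local Notation psi := (gauge_function B f).

Let Bf : B f. Proof. exact: interior_subset. Qed.

Let G r rho := 0 < rho /\ B (f + rho^-1 *: r).

Let gaugeE r : psi r = inf [set rho | G r rho].
Proof.
rewrite /gauge_function; congr inf; apply/seteqP; split=> rho /= [rho0].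
  by move=> [b Bb bE]; split=> //; rewrite -bE addrC subrK.
by move=> Br; split=> //; exists (f + rho^-1 *: r) => //; rewrite addrC addKr.
Qed.

Let G_up r rho rho' : G r rho -> rho <= rho' -> G r rho'.
Proof.
move=> [rho0 Br] le; have rho'0 : 0 < rho' by exact: lt_le_trans le.
split=> //.
have -> : f + rho'^-1 *: r =
    (rho / rho') *: (f + rho^-1 *: r) + (1 - rho / rho') *: f.
  rewrite scalerDr scalerA mulrAC divff ?gt_eqF // mul1r.
  by apply/colP => i; rewrite !mxE; ring.
apply: (iffLR (convex_setP B) B_convex) => //; first by apply: divr_ge0; exact: ltW.
by rewrite ler_pdivrMr // mul1r.
Qed.

Let G_nonempty r : exists rho, G r rho.
Proof.
have [e e0 He] := iffLR (interior_ballP B f) f_int.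
have r0 : 0 < `|r| + 1 by rewrite ltr_wpDl.
exists ((`|r| + 1) / e); split; first exact: divr_gt0.
apply: He; rewrite opprD addrA subrr add0r normrN normrZ invf_div.
rewrite gtr0_norm ?divr_gt0 // mulrAC ltr_pdivrMr // ltr_pM2l //.
by rewrite ltrDl.
Qed.

Let G_lb r : lbound [set rho | G r rho] 0.
Proof. by move=> rho [/ltW]. Qed.

Lemma gauge_lt r rho : psi r < rho -> 0 < rho /\ B (f + rho^-1 *: r).
Proof.
rewrite gaugeE => lt; have [r1 G1 lt1] := inf_lt (G_nonempty r) lt.
exact: G_up G1 (ltW lt1).
Qed.

Let gauge_le r rho : G r rho -> psi r <= rho.
Proof. by move=> Gr; rewrite gaugeE; apply: ge_inf => //; exists 0; exact: G_lb. Qed.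

Lemma gauge_ge0 r : 0 <= psi r.
Proof. by rewrite gaugeE; apply: lb_le_inf => //; exact: G_nonempty. Qed.

Lemma gauge_subadditive x y : psi (x + y) <= psi x + psi y.
Proof.
apply/ler_addgt0Pr => e e0.
have [|p0 Bp] := @gauge_lt x (psi x + e / 2); first lra.
have [|q0 Bq] := @gauge_lt y (psi y + e / 2); first lra.
set p := psi x + _ in p0 Bp; set q := psi y + _ in q0 Bq.
have -> : psi x + psi y + e = p + q by rewrite /p /q; lra.
have pq0 : 0 < p + q by exact: addr_gt0.
apply: gauge_le; split=> //.
have -> : f + (p + q)^-1 *: (x + y) =
    (p / (p + q)) *: (f + p^-1 *: x) + (1 - p / (p + q)) *: (f + q^-1 *: y).
  apply/colP => i; rewrite !mxE; field.
  by rewrite !gt_eqF.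
apply: (iffLR (convex_setP B) B_convex) => //; first by apply: divr_ge0; exact: ltW.
by rewrite ler_pdivrMr // mul1r; lra.
Qed.

Lemma gauge_homogeneous t x : 0 <= t -> psi (t *: x) <= psi x * t.
Proof.
rewrite le_eqVlt => /orP [/eqP <-|t0].
  rewrite scale0r mulr0; apply/ler_addgt0Pr => e e0.
  by apply: gauge_le; split; rewrite ?add0r // scaler0 addr0.
apply/ler_addgt0Pr => e e0; have et0 : 0 < e / t by exact: divr_gt0.
have [|p0 Bp] := @gauge_lt x (psi x + e / t); first lra.
have -> : psi x * t + e = (psi x + e / t) * t by rewrite mulrDl divfK // gt_eqF.
apply: gauge_le; split; first exact: mulr_gt0.
by rewrite scalerA invfM -mulrA mulVf ?gt_eqF // mulr1.
Qed.

(** Otherwise [z] would lie strictly between [f] and a point of [B], hence in the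
interior of [B]. *)
Lemma gauge_integral z : Zn z -> 1 <= psi (z - f).
Proof.
move=> zZ; rewrite leNgt; apply/negP => lt1.
have [|p0 Bp] := @gauge_lt (z - f) ((1 + psi (z - f)) / 2); first lra.
set p := (1 + _) / 2 in p0 Bp; have p1 : p < 1 by rewrite /p; lra.
suff : (B° `&` Zn) z by rewrite B_free.
split=> //.
have -> : z = (1 - p) *: f + (1 - (1 - p)) *: (f + p^-1 *: (z - f)).
  by apply/colP => i; rewrite !mxE; field; rewrite gt_eqF.
by apply: convex_interior => //; lra.
Qed.

Lemma gauge_norm x : `|x| <= K * psi x.
Proof.
have K0 : 0 <= K by apply: le_trans (B_bounded Bf).
apply/ler_addgt0Pr => e e0; have K10 : 0 < K + 1 by lra.
have eK0 : 0 < e / (K + 1) by exact: divr_gt0.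
have [|p0 Bp] := @gauge_lt x (psi x + e / (K + 1)); first lra.
have := B_bounded Bp; rewrite addrC addKr normrZ gtr0_norm ?invr_gt0 //.
rewrite ler_pdivrMl // => le1; apply: le_trans le1 _.
have : K * (e / (K + 1)) <= e.
  by rewrite mulrA ler_pdivrMr // mulrC ler_wpM2l //; lra.
by lra.
Qed.

Theorem unique_lifting_gauge_pair p q tol :
  (exists! pi, minimal_lifting f psi pi) ->
  p + q = - f -> ~ Zn p -> ~ Zn q -> ~ Zn (q - p) -> 0 < tol ->
  exists w w', [/\ Zn w, Zn w' & psi (p + w) + psi (q + w') < 1 + tol].
Proof.
exact: (unique_lifting_pair gauge_ge0 gauge_subadditive gauge_homogeneous
  gauge_integral gauge_norm).
Qed.

End Gauge.

(** * Finitely generated cones *)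

Section Cones.
Variables (R : realType) (n : nat).
Local Notation V := 'cV[R]_n.
Local Notation Vd := 'rV[R]_n.
Implicit Types (u : Vd) (x y : V) (rs : seq V) (us : seq Vd).

Definition dot u x : R := (u *m x) 0 0.

Lemma dotDr u x y : dot u (x + y) = dot u x + dot u y.
Proof. by rewrite /dot mulmxDr mxE. Qed.

Lemma dotZr u t x : dot u (t *: x) = t * dot u x.
Proof. by rewrite /dot -scalemxAr mxE. Qed.

Lemma dotNr u x : dot u (- x) = - dot u x.
Proof. by rewrite /dot mulmxN mxE. Qed.

Lemma dotBr u x y : dot u (x - y) = dot u x - dot u y.
Proof. by rewrite dotDr dotNr. Qed.

Lemma dot0r u : dot u 0 = 0.
Proof. by rewrite /dot mulmx0 mxE. Qed.

Lemma dotDl u u' x : dot (u + u') x = dot u x + dot u' x.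
Proof. by rewrite /dot mulmxDl mxE. Qed.

Lemma dotZl u t x : dot (t *: u) x = t * dot u x.
Proof. by rewrite /dot -scalemxAl mxE. Qed.

Lemma dot_sumr u I (l : seq I) (F : I -> V) :
  dot u (\sum_(i <- l) F i) = \sum_(i <- l) dot u (F i).
Proof. by rewrite /dot mulmx_sumr summxE. Qed.

Lemma dot_delta i x : dot (delta_mx 0 i) x = x i 0.
Proof. by rewrite /dot -rowE mxE. Qed.

Definition dotE := (dotDr, dotZr, dotNr, dot0r, dotDl, dotZl).

Lemma dot_norm u : exists2 L, 0 < L & forall x, `|dot u x| <= L * `|x|.
Proof.
exists (1 + \sum_i `|u 0 i|) => [|x]; first by rewrite ltr_wpDr // sumr_ge0.
rewrite /dot mxE mulrDl mul1r; apply: le_trans (ler_norm_sum _ _ _) _.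
rewrite ler_wpDl // mulr_suml; apply: ler_sum => i _.
by rewrite normrM ler_wpM2l // mx_entry_le_norm.
Qed.

(** The cone generated by a list, defined by peeling off generators so that
Fourier-Motzkin elimination is an induction on the list. *)
Fixpoint cone rs x : Prop :=
  if rs is r :: rs' then exists2 t, 0 <= t & cone rs' (x - t *: r) else x = 0.

Lemma cone0 rs : cone rs 0.
Proof. by elim: rs => //= r rs IH; exists 0; rewrite // scale0r subr0. Qed.

Lemma coneD rs x y : cone rs x -> cone rs y -> cone rs (x + y).
Proof.
elim: rs x y => [|r rs IH] x y /=; first by move=> -> ->; rewrite addr0.
move=> [s s0 xs] [t t0 yt]; exists (s + t); first exact: addr_ge0.
by rewrite scalerDl opprD addrACA; apply: IH.
Qed.

Lemma coneZ rs c x : 0 <= c -> cone rs x -> cone rs (c *: x).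
Proof.
move=> c0; elim: rs x => [|r rs IH] x /=; first by move=> ->; rewrite scaler0.
move=> [t t0 xt]; exists (c * t); first exact: mulr_ge0.
by rewrite -scalerA -scalerBr; apply: IH.
Qed.

Lemma cone_mem rs r : r \in rs -> cone rs r.
Proof.
elim: rs => // r' rs IH; rewrite inE => /orP [/eqP ->|/IH H] /=.
  by exists 1 => //; rewrite scale1r subrr; apply: cone0.
by exists 0 => //; rewrite scale0r subr0.
Qed.

Lemma cone_sum rs I (l : seq I) (c : I -> R) (v : I -> V) :
  (forall i, 0 <= c i) -> (forall i, v i \in rs) ->
  cone rs (\sum_(i <- l) c i *: v i).
Proof.
move=> c0 vr; elim/big_ind: _ => [|x y|i _]; first exact: cone0.
  exact: coneD.
by apply: coneZ => //; apply: cone_mem.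
Qed.

(** When all generators have height 1, a point of the cone can be built generator
by generator while recording its height. *)
Lemma cone_height_ind (P : R -> V -> Prop) rs h x :
  (forall r, r \in rs -> dot h r = 1) ->
  P 0 0 ->
  (forall t r s y, 0 <= t -> 0 <= s -> r \in rs -> P s y -> P (t + s) (t *: r + y)) ->
  cone rs x -> 0 <= dot h x /\ P (dot h x) x.
Proof.
move=> hr P0 PS; have : {subset rs <= rs} by [].
move: {1 3}rs => ss; elim: ss x => [|r ss IH] x /= sub.
  by move=> ->; rewrite dot0r.
move=> [t t0 /IH [y|le Pt]]; first by move=> yss; apply: sub; rewrite inE yss orbT.
have rr : r \in rs by apply: sub; rewrite inE eqxx.
rewrite dotBr dotZr (hr _ rr) mulr1 in le Pt.
have := PS t r _ _ t0 le rr Pt.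
by rewrite [t + _]addrC [t *: r + _]addrC !subrK => Px; split=> //; lra.
Qed.

(** Fourier-Motzkin elimination: membership of [x] in the cone of [r :: rs] asks for
some [t >= 0] with [x - t *: r] in the cone of [rs], that is, a system of lower and
upper bounds on [t], which is solvable when each lower bound is at most each
upper bound. *)
Lemma cone_halfspaces rs :
  exists us, forall x, cone rs x <-> forall u, u \in us -> 0 <= dot u x.
Proof.
elim: rs => [|r rs [us Hus]].
  exists ([seq delta_mx 0 i | i <- enum 'I_n] ++ [seq - delta_mx 0 i | i <- enum 'I_n]).
  move=> x; split=> [->|H] /=; first by move=> u _; rewrite dot0r.
  apply/colP => i; rewrite mxE; apply/eqP; rewrite eq_le -oppr_ge0; apply/andP; split.
    rewrite -dot_delta -mulN1r -dotZl scaleN1r; apply: H; rewrite mem_cat.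
    by apply/orP; right; apply/mapP; exists i; rewrite ?mem_enum.
  rewrite -dot_delta; apply: H; rewrite mem_cat.
  by apply/orP; left; apply/mapP; exists i; rewrite ?mem_enum.
pose pos := [seq u <- us | 0 <= dot u r].
pose neg := [seq u <- us | dot u r < 0].
pose comb := [seq dot v r *: u - dot u r *: v | u <- neg, v <- pos].
exists (pos ++ comb) => x; split.
  move=> /= [t t0 /Hus xt].
  have H u : u \in us -> t * dot u r <= dot u x.
    by move=> /xt; rewrite dotBr dotZr subr_ge0.
  have Hpos u : u \in pos -> [/\ u \in us, 0 <= dot u r & 0 <= dot u x].
    rewrite mem_filter => /andP [ur uu]; split=> //.
    by apply: le_trans (H u uu); exact: mulr_ge0.
  move=> u; rewrite mem_cat => /orP [/Hpos [] //|/allpairsP [[v w] /= [vn wp ->]]].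
  move: vn; rewrite mem_filter => /andP [vr /H Hv].
  have [/H Hw wr _] := Hpos w wp.
  rewrite dotDl -scaleNr !dotZl.
  have : dot w r * (t * dot v r) <= dot w r * dot v x by rewrite ler_wpM2l.
  have : - dot v r * (t * dot w r) <= - dot v r * dot w x by rewrite ler_wpM2l //; lra.
  lra.
move=> H.
have Hp u : u \in pos -> 0 <= dot u x by move=> uu; apply: H; rewrite mem_cat uu.
have Hc u v : u \in neg -> v \in pos -> dot u r * dot v x <= dot v r * dot u x.
  move=> un vp; rewrite -subr_ge0 -mulNr -!dotZl -dotDl scaleNr; apply: H.
  by rewrite mem_cat; apply/orP; right; apply/allpairsP; exists (u, v).
have [t [t0 tn tp]] : exists t, [/\ 0 <= t,
    forall u, u \in neg -> dot u x / dot u r <= t &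
    (t = 0 \/ exists2 u, u \in neg & t = dot u x / dot u r)].
  elim: neg {Hc comb H} => [|u s [t [t0 tn tp]]]; first by exists 0; split=> //; left.
  have [le|lt] := leP (dot u x / dot u r) t.
    exists t; split=> // [v|]; first by rewrite inE => /orP [/eqP ->|/tn].
    case: tp => [|[v vs tv]]; first by left.
    by right; exists v; rewrite // inE vs orbT.
  exists (dot u x / dot u r); split; first by lra.
    by move=> v; rewrite inE => /orP [/eqP ->//|/tn]; lra.
  by right; exists u; rewrite // inE eqxx.
exists t => //; apply/Hus => u uu; rewrite dotBr dotZr subr_ge0.
have [ur|ur] := leP 0 (dot u r); last first.
  by rewrite -ler_ndivrMr // tn // mem_filter ur.
have up : u \in pos by rewrite mem_filter ur.
case: tp => [->|[v vn ->]]; first by rewrite mul0r Hp.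
have vr : dot v r < 0 by move: vn; rewrite mem_filter => /andP [].
by rewrite mulrAC ler_ndivrMr // mulrC [leRHS]mulrC Hc.
Qed.

(** In a description by the smallest possible number of inequalities, dropping one
of them admits a point that violates it. *)
Lemma cone_facets rs : exists m (u : 'I_m -> Vd),
  (forall x, cone rs x <-> forall i, 0 <= dot (u i) x) /\
  (forall i, exists2 x, dot (u i) x < 0 & forall j, j != i -> 0 <= dot (u j) x).
Proof.
pose P m := `[< exists u : 'I_m -> Vd, forall x, cone rs x <-> forall i, 0 <= dot (u i) x >].
have exP : exists m, P m.
  have [us Hus] := cone_halfspaces rs.
  exists (size us); apply/asboolP; exists (fun i => nth 0 us i) => x.
  rewrite Hus; split=> [H i|H u uu]; first by apply: H; rewrite mem_nth.
  have uu' := uu; rewrite -index_mem in uu'.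
  by have := H (Ordinal uu'); rewrite /= nth_index.
case: (ex_minnP exP) => m /asboolP [u Hu] min_m.
exists m, u; split=> // i; apply: contrapT => Hi.
case: m u Hu min_m i Hi => [|m] u Hu min_m i Hi; first by case: i {Hi}.
have : (m.+1 <= m)%N; last by rewrite ltnn.
apply: min_m; apply/asboolP; exists (fun j => u (lift i j)) => x.
rewrite Hu; split=> [H j|H k]; first exact: H.
have [->|ki] := eqVneq k i; last first.
  by move: ki; rewrite eq_sym => /unlift_some [j -> _]; apply: H.
rewrite leNgt; apply/negP => lt0; apply: Hi; exists x => // j ji.
by move: ji; rewrite eq_sym => /unlift_some [l -> _]; apply: H.
Qed.

Lemma cone_height_ge0 rs h x : (forall r, r \in rs -> dot h r = 1) ->
  cone rs x -> 0 <= dot h x.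
Proof. by move=> hr /(cone_height_ind (P := fun _ _ => True) hr I) []. Qed.

Lemma cone_height_eq0 rs h x : (forall r, r \in rs -> dot h r = 1) ->
  cone rs x -> dot h x = 0 -> x = 0.
Proof.
move=> hr /(cone_height_ind (P := fun t y => 0 <= t /\ (t = 0 -> y = 0)) hr) [//||_ [_ ?] //].
move=> t r t' y t0 t'0 rr [_ yz]; split=> [|tt0]; first exact: addr_ge0.
have t00 : t = 0 by lra. have t'00 : t' = 0 by lra.
by rewrite yz // t00 scale0r addr0.
Qed.

Lemma cone_norm rs h : (forall r, r \in rs -> dot h r = 1) ->
  exists K, forall x, cone rs x -> `|x| <= K * dot h x.
Proof.
move=> hr; pose K := \sum_(r <- rs) `|r|.
have rK r : r \in rs -> `|r| <= K.
  by move=> rr; rewrite /K (big_rem r) //= lerDl sumr_ge0.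
exists K => x /(cone_height_ind (P := fun t y => `|y| <= K * t) hr) [||//].
  by rewrite normr0 mulr0.
move=> t r t' y t0 t'0 rr yK; apply: le_trans (ler_normD _ _) _.
by rewrite mulrDr lerD // normrZ ger0_norm // mulrC ler_wpM2r // rK.
Qed.

(** The point of the cone at height 1 in direction [x] is a convex combination of the
generators. *)
Lemma cone_section (X : set V) a rs h x : @convex_set R V X ->
  (forall r, r \in rs -> dot h r = 1) -> (forall r, r \in rs -> X (a + r)) ->
  cone rs x -> 0 < dot h x -> X (a + (dot h x)^-1 *: x).
Proof.
move=> X_convex hr rX.
move=> /(cone_height_ind (P := fun t y => [/\ 0 <= t, t = 0 -> y = 0 &
  0 < t -> X (a + t^-1 *: y)]) hr) [||_ [_ _ ?] //]; first by split=> //; rewrite ltxx.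
move=> t r t' y t0 t'0 rr [_ yz yP].
split=> [|tt0|tt0]; first exact: addr_ge0.
  have t00 : t = 0 by lra. have t'00 : t' = 0 by lra.
  by rewrite yz // t00 scale0r addr0.
have [t'00|t'0'] := eqVneq t' 0.
  rewrite (yz t'00) t'00 !addr0 scalerA mulVf ?scale1r; first exact: rX.
  by rewrite t'00 addr0 in tt0; rewrite gt_eqF.
have t'gt : 0 < t' by rewrite lt_neqAle eq_sym t'0'.
have -> : a + (t + t')^-1 *: (t *: r + y) =
    (t / (t + t')) *: (a + r) + (1 - t / (t + t')) *: (a + t'^-1 *: y).
  by apply/colP => i; rewrite !mxE; field; rewrite !gt_eqF.
have c0 : 0 <= t / (t + t') by apply: divr_ge0 => //; exact: ltW.
have c1 : t / (t + t') <= 1 by rewrite ler_pdivrMr ?mul1r //; lra.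
exact: (iffLR (convex_setP X) X_convex _ _ _ (rX r rr) (yP t'gt) c0 c1).
Qed.

Lemma cone_truncation (X : set V) a rs h x : @convex_set R V X -> X a ->
  (forall r, r \in rs -> dot h r = 1) -> (forall r, r \in rs -> X (a + r)) ->
  cone rs x -> dot h x <= 1 -> X (a + x).
Proof.
move=> X_convex Xa hr rX xc x1.
have := cone_height_ge0 hr xc; rewrite le_eqVlt => /orP [/eqP h0|h0].
  by rewrite (cone_height_eq0 hr xc (esym h0)) addr0.
have -> : a + x = dot h x *: (a + (dot h x)^-1 *: x) + (1 - dot h x) *: a.
  by apply/colP => i; rewrite [LHS]/= !mxE; field; rewrite gt_eqF.
apply: (iffLR (convex_setP X) X_convex) => //; last exact: ltW.
exact: (cone_section X_convex hr rX xc h0).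
Qed.

End Cones.

(** * Pyramids *)

Section Pyramids.
Variables (R : realType) (n : nat).
Local Notation V := 'cV[R]_n.
Local Notation Vd := 'rV[R]_n.
Implicit Types (u h : Vd) (x y a : V) (rs s : seq V).

(** An affine set is closed under combinations with coefficient sum 1; writing them
relative to [p0] avoids partial sums that vanish. *)
Lemma affine_set_sum (Y : set V) (p0 : V) I (l : seq I) (c : I -> R) (p : I -> V) :
  affine_set Y -> Y p0 -> (forall i, Y (p i)) ->
  Y (p0 + \sum_(i <- l) c i *: (p i - p0)).
Proof.
move=> Yaff Y0 Yp.
have YZ t v : Y (p0 + v) -> Y (p0 + t *: v).
  move=> Yv; have := Yaff _ _ t Y0 Yv.
  by congr (Y _); apply/colP => i; rewrite !mxE; ring.
elim/big_ind: _ => [|x y Yx Yy|i _]; first by rewrite addr0.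
  have := YZ 2 (2^-1 *: (x + y)); rewrite scalerA divff // scale1r; apply.
  have := Yaff _ _ 2^-1 Yx Yy; congr (Y _).
  by apply/colP => i; rewrite !mxE; field.
by apply: YZ; rewrite addrC subrK.
Qed.

(** If no functional takes the value 1 on all [p - a], then by linear algebra these
vectors satisfy a linear relation with nonzero coefficient sum, which exhibits
[a] as an affine combination of [s]. *)
Lemma exists_height s a : ~ aff_hull [set` s] a ->
  exists h, forall p, p \in s -> dot h (p - a) = 1.
Proof.
move=> sa; pose M : 'M[R]_(n, size s) := \matrix_(i, j) (nth 0 s j - a) i 0.
have Mcol (w : Vd) (j : 'I_(size s)) : (w *m M) 0 j = dot w (nth 0 s j - a).
  by rewrite /dot !mxE; apply: eq_bigr => i _; rewrite !mxE.
case sub : ((const_mx 1 : 'rV[R]_(size s)) <= M)%MS.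
  have /submxP [h hM] := sub.
  exists h => p ps; have ps' := ps; rewrite -index_mem in ps'.
  by rewrite -[p in LHS](nth_index 0 ps) -(Mcol h (Ordinal ps')) -hM mxE.
case: sa; move: sub; rewrite submxE => /negbT /eqP sub.
have [k Hk] : exists k, (const_mx 1 *m cokermx M) (0 : 'I_1) k <> 0.
  apply/existsNP => H; apply: sub; apply/rowP => k; by rewrite H mxE.
pose c := col k (cokermx M).
have Mc : M *m c = 0.
  apply/colP => i; have := congr1 (fun X : 'M[R]_(n, size s) => X i k) (mulmx_coker M).
  rewrite !mxE => Mk; transitivity (\sum_j M i j * cokermx M j k) => //.
  by apply: eq_bigr => j _; rewrite [c _ _]mxE.
have cE : (const_mx 1 *m cokermx M) (0 : 'I_1) k = \sum_j c j 0.
  by rewrite mxE; apply: eq_bigr => j _; rewrite !mxE mul1r.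
rewrite cE in Hk; set sg := \sum_j c j 0 in Hk.
have [j0 _] : exists j : 'I_(size s), True.
  by apply: contrapT => /forallNP H; apply: Hk; rewrite /sg big1 // => j; case: (H j).
pose p (j : 'I_(size s)) := nth 0 s j.
move=> Y [Yaff Ys]; have Yp j : Y (p j) by apply: Ys; exact: mem_nth.
have := affine_set_sum (index_enum 'I_(size s)) (fun j => sg^-1 * c j 0) Yaff (Yp j0) Yp.
congr (Y _); apply/colP => i; rewrite !mxE summxE.
have := congr1 (fun X : 'cV[R]_n => X i 0) Mc; rewrite !mxE => Mci.
transitivity (p j0 i 0 + sg^-1 * (\sum_j (M i j * c j 0) + sg * (a i 0 - p j0 i 0))).
  congr (_ + _); rewrite [sg * _]mulr_suml -big_split mulr_sumr /=; apply: eq_bigr => j _.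
  by rewrite [M _ _]mxE !mxE /p; ring.
by rewrite Mci add0r mulKf ?subrKC //; apply/eqP.
Qed.

Lemma open_halfspaces m (u : 'I_m -> Vd) x : (forall i, 0 < dot (u i) x) ->
  exists2 e, 0 < e & forall y, `|x - y| < e -> forall i, 0 < dot (u i) y.
Proof.
move=> ux.
have H i : exists e, 0 < e /\ forall y, `|x - y| < e -> 0 < dot (u i) y.
  have [L L0 HL] := dot_norm (u i).
  exists (dot (u i) x / L); split=> [|y]; first exact: divr_gt0.
  rewrite ltr_pdivlMr // mulrC => lty; have := le_lt_trans (HL (x - y)) lty.
  by rewrite dotBr ltr_norml => /andP [_]; lra.
have [e He] := choice H.
have [d d0 Hd] := @finite_gap R 'I_m setT e (@finite_finset _ setT).
exists d => // y lty i; have [ei Hi] := He i; apply: Hi.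
exact: lt_le_trans lty (Hd i I ei).
Qed.

Section Description.
Variables (B P0 : set V) (a z0 : V).
Hypothesis B_pyramid : pyramid B P0 a.
Hypothesis B_full : aff_hull B = setT.
Hypothesis z0_relint : relint P0 z0.

(** The pyramid as the part below height 1 of a cone with apex [a], given by one
functional per facet through the apex. The functionals are scaled to be 1 on
[z0 - a], which is possible because [z0] is in the relative interior of the base.
*)
Lemma pyramid_description : exists m (u : 'I_m -> Vd) h K,
  [/\ forall x, B x <-> (forall i, 0 <= dot (u i) (x - a)) /\ dot h (x - a) <= 1,
      (forall i, dot (u i) (z0 - a) = 1) /\ dot h (z0 - a) = 1,
      forall i, exists2 q, dot (u i) q < 0 & forall j, j != i -> 0 <= dot (u j) q,
      forall x, (forall i, 0 <= dot (u i) x) -> `|x| <= K * dot h x &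
      forall x, (forall i, 0 < dot (u i) (x - a)) -> dot h (x - a) = 1 -> relint P0 x].
Proof.
have [[A /finite_seqP [s As] P0E] aP0 BE] := B_pyramid.
have P0_convex : @convex_set R V P0 by rewrite P0E; apply: conv_hull_convex.
have sP0 p : p \in s -> P0 p.
  by move=> ps; rewrite P0E; apply: sub_gen_smallest; rewrite As.
have B_convex : @convex_set R V B by rewrite BE; apply: conv_hull_convex.
have P0B p : P0 p -> B p by move=> P0p; rewrite BE; apply: sub_gen_smallest; left.
have Ba : B a by rewrite BE; apply: sub_gen_smallest; right.
have [h hs] : exists h, forall p, p \in s -> dot h (p - a) = 1.
  apply: exists_height => sa; apply: aP0 => Y [Yaff YP0].
  by apply: sa; split=> // p /sP0 /YP0.
pose rs := [seq p - a | p <- s].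
have hr r : r \in rs -> dot h r = 1 by move=> /mapP [p /hs ph ->].
have rP0 r : r \in rs -> P0 (a + r).
  by move=> /mapP [p /sP0 ps ->]; rewrite addrC subrK.
have P0_cone x : P0 x -> cone rs (x - a) /\ dot h (x - a) = 1.
  rewrite P0E; move: x; apply: smallest_sub => [|p]; last first.
    rewrite As => ps; split; last exact: hs.
    by apply: cone_mem; apply/mapP; exists p.
  apply/convex_setP => x y t [xc xh] [yc yh] t0 t1.
  have -> : t *: x + (1 - t) *: y - a = t *: (x - a) + (1 - t) *: (y - a).
    by apply/colP => i; rewrite !mxE; ring.
  split; last by rewrite !dotE in xh yh *; rewrite xh yh; lra.
  by apply: coneD; apply: coneZ => //; lra.
have BP x : B x <-> cone rs (x - a) /\ dot h (x - a) <= 1.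
  split; last first.
    move=> [xc x1]; rewrite -(subrKC a x).
    by apply: (cone_truncation B_convex Ba hr _ xc x1) => r /rP0 /P0B.
  rewrite BE; move: x; apply: smallest_sub => [|p]; last first.
    move=> [/P0_cone [? ->] //|->]; rewrite subrr dot0r; split=> //; exact: cone0.
  apply/convex_setP => x y t [xc xh] [yc yh] t0 t1.
  have -> : t *: x + (1 - t) *: y - a = t *: (x - a) + (1 - t) *: (y - a).
    by apply/colP => i; rewrite !mxE; ring.
  split; first by apply: coneD; apply: coneZ => //; lra.
  rewrite dotDr !dotZr.
  have : t * dot h (x - a) <= t * 1 by rewrite ler_wpM2l.
  have : (1 - t) * dot h (y - a) <= (1 - t) * 1 by rewrite ler_wpM2l //; lra.
  lra.
have dot0 u : (forall r, r \in rs -> dot u r = 0) -> forall x, dot u x = 0.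
  move=> ur; have cu y : cone rs y -> dot u y = 0.
    elim: (rs) y ur => [|r s' IH] y ur /=; first by move=> ->; rewrite dot0r.
    move=> [t t0 /IH]; rewrite dotBr dotZr (ur r) ?inE ?eqxx // mulr0 subr0; apply.
    by move=> r' r's; apply: ur; rewrite inE r's orbT.
  have H y : dot u (y - a) = 0.
    suff : aff_hull B `<=` [set y | dot u (y - a) = 0] by rewrite B_full; apply.
    apply: smallest_sub => [x z t /= xu zu|z /BP [zc _]]; last exact: cu.
    by move: xu zu; rewrite !dotE; move: (dot u x) (dot u z) (dot u a) => X Z A1; nra.
  by move=> x; have := H (x + a); rewrite addrK.
have pos_z0 u : (forall r, r \in rs -> 0 <= dot u r) -> dot u (z0 - a) = 0 ->
    forall x, dot u x = 0.
  move=> ur uz0; apply: dot0 => r rr; apply/eqP; rewrite eq_le ur // andbT.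
  have [P0z0 /nbhs_ballP [e /= e0 He]] := z0_relint.
  (* Moving from [z0] slightly away from [a + r] stays in the base. *)
  pose t := e / (2 * (`|z0 - (a + r)| + 1)).
  have N0 : 0 < `|z0 - (a + r)| + 1 by rewrite ltr_wpDl.
  have t0 : 0 < t by rewrite divr_gt0 // mulr_gt0.
  pose y := z0 + t *: (z0 - (a + r)).
  have aff_P0 p : P0 p -> aff_hull P0 p by apply: sub_gen_smallest.
  have /P0_cone [yc _] : P0 y.
    apply: He.
      rewrite -ball_normE /= /y opprD addrA subrr add0r normrN normrZ gtr0_norm //.
      rewrite /t mulrAC ltr_pdivrMr ?mulr_gt0 // ltr_pM2l //; lra.
    move=> Y [Yaff YP0].
    have := Yaff _ _ (- t) (YP0 _ P0z0) (YP0 _ (rP0 _ rr)).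
    by congr (Y _); apply/colP => i; rewrite !mxE; ring.
  have cu x : cone rs x -> 0 <= dot u x.
    elim: (rs) x ur => [|r' s' IH] x ur /=; first by move=> ->; rewrite dot0r.
    move=> [t' t'0 /IH]; rewrite dotBr dotZr => H.
    have := mulr_ge0 t'0 (ur r' _); rewrite inE eqxx => /(_ isT).
    suff : 0 <= dot u x - t' * dot u r' by lra.
    by apply: H => r'' r''s; apply: ur; rewrite inE r''s orbT.
  have := cu _ yc.
  have -> : dot u (y - a) = (1 + t) * dot u (z0 - a) - t * dot u r.
    by rewrite /y !dotE; ring.
  by rewrite uz0 mulr0 add0r oppr_ge0 pmulr_rle0.
have [m [u [uc uq]]] := cone_facets rs.
have [z0c z0h] := P0_cone _ z0_relint.1.
have us i : 0 < dot (u i) (z0 - a).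
  rewrite lt_neqAle (iffLR (uc _) z0c) andbT; apply/eqP => us0.
  have [q uq0 _] := uq i; suff ui0 : dot (u i) q = 0 by rewrite ui0 ltxx in uq0.
  apply: pos_z0 => // r rr; exact: (iffLR (uc _) (cone_mem rr)).
pose v i := (dot (u i) (z0 - a))^-1 *: u i.
have v_ge0 i x : (0 <= dot (v i) x) = (0 <= dot (u i) x).
  by rewrite /v dotZl pmulr_rge0 // invr_gt0.
have v_gt0 i x : (0 < dot (v i) x) = (0 < dot (u i) x).
  by rewrite /v dotZl pmulr_rgt0 // invr_gt0.
have vc x : cone rs x <-> forall i, 0 <= dot (v i) x.
  by rewrite uc; split=> H i; have := H i; rewrite v_ge0.
have [K HK] := cone_norm hr.
exists m, v, h, K; split.
- by move=> x; rewrite BP vc.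
- split=> // i; by rewrite /v dotZl mulVf // gt_eqF.
- move=> i; have [q q0 Hq] := uq i; exists q.
    by rewrite ltNge v_ge0 -ltNge.
  by move=> j /Hq; rewrite v_ge0.
- by move=> x /vc; exact: HK.
- move=> x xv xh.
  have P0x y : (forall i, 0 < dot (v i) (y - a)) -> dot h (y - a) = 1 -> P0 y.
    move=> yv yh; have := cone_section (x := y - a) P0_convex hr rP0.
    rewrite yh invr1 scale1r subrKC; apply=> //.
    by apply/vc => i; exact: ltW.
  split; first exact: P0x.
  have [e e0 He] := open_halfspaces xv.
  apply/nbhs_ballP; exists e => //= y; rewrite -ball_normE /= => xy yaff.
  apply: P0x; first by apply: He; rewrite opprB addrA subrK.
  suff : aff_hull P0 `<=` [set y | dot h (y - a) = 1] by apply.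
  apply: smallest_sub => [p p' t /= ph p'h|p /P0_cone [] //].
  by move: ph p'h; rewrite !dotE; move: (dot h p) (dot h p') (dot h a) => X Z A1; nra.
Qed.

End Description.

End Pyramids.

(** * Pyramids with unique lifting *)

Section UniqueLiftingPyramid.
Variables (R : realType) (n : nat).
Local Notation V := 'cV[R]_n.
Local Notation Vd := 'rV[R]_n.
Local Notation Zn := (@integral_point R n).
Variables (B P0 : set V) (a z0 : V) (m : nat) (u : 'I_m -> Vd) (h : Vd) (K : R).
Local Notation s := (z0 - a).
Hypothesis BP : forall x, B x <-> (forall i, 0 <= dot (u i) (x - a)) /\ dot h (x - a) <= 1.
Hypothesis us : forall i, dot (u i) s = 1.
Hypothesis hs : dot h s = 1.
Hypothesis u_facet :
  forall i, exists2 q, dot (u i) q < 0 & forall j, j != i -> 0 <= dot (u j) q.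
Hypothesis u_norm : forall x, (forall i, 0 <= dot (u i) x) -> `|x| <= K * dot h x.
Hypothesis u_relint :
  forall x, (forall i, 0 < dot (u i) (x - a)) -> dot h (x - a) = 1 -> relint P0 x.
Hypothesis B_free : B° `&` Zn = set0.
Hypothesis z0Z : Zn z0.
Hypothesis z0_unique : forall z, relint P0 z -> Zn z -> z0 = z.
Hypothesis B_unique : unique_lifting B.

Local Ltac pure_lra := clear - BP us hs u_facet u_norm u_relint B_free z0Z z0_unique
  B_unique; intros; lra.

Lemma B_convex : @convex_set R V B.
Proof.
apply/convex_setP => x y t /BP [xu xh] /BP [yu yh] t0 t1; apply/BP.
have -> : t *: x + (1 - t) *: y - a = t *: (x - a) + (1 - t) *: (y - a).
  by apply/colP => i; rewrite !mxE; ring.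
have t1' : 0 <= 1 - t by lra.
split=> [i|]; rewrite dotDr !dotZr; first by rewrite addr_ge0 ?mulr_ge0.
have : t * dot h (x - a) <= t * 1 by rewrite ler_wpM2l.
have : (1 - t) * dot h (y - a) <= (1 - t) * 1 by rewrite ler_wpM2l.
lra.
Qed.

Lemma shiftB x y : x - a - (y - a) = x - y.
Proof. by rewrite opprB addrA subrK. Qed.

Lemma interiorB x : (forall i, 0 < dot (u i) (x - a)) -> dot h (x - a) < 1 -> B° x.
Proof.
move=> xu xh; have [e e0 He] := open_halfspaces xu.
have zxh : forall i : 'I_1, 0 < dot ((fun=> h) i) (z0 - x).
  by move=> _; rewrite -(shiftB z0 x) dotBr hs; lra.
have [d d0 Hd] := open_halfspaces zxh.
apply/interior_ballP; exists (Num.min e d); first by rewrite lt_min e0.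
move=> y; rewrite lt_min => /andP [xye xyd]; apply/BP; split=> [i|].
  by apply/ltW/He; rewrite shiftB.
have hy : dot h (z0 - y) = 1 - dot h (y - a) by rewrite -(shiftB z0 y) dotBr hs.
suff : 0 < dot h (z0 - y) by rewrite hy subr_gt0 => /ltW.
apply: (Hd (z0 - y) _ 0); have -> : z0 - x - (z0 - y) = - (x - y).
  by apply/colP => i; rewrite !mxE; ring.
by rewrite normrN.
Qed.

(** Lattice points strictly inside the cone and below height 1 would be interior to
[B], and at height 1 they would be in the relative interior of the base. *)
Lemma lattice_point_unique z : Zn z -> (forall i, 0 < dot (u i) (z - a)) ->
  dot h (z - a) <= 1 -> z = z0.
Proof.
move=> zZ zu; rewrite le_eqVlt => /orP [/eqP zh|zh].
  by apply/esym/z0_unique => //; exact: u_relint.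
suff : (B° `&` Zn) z by rewrite B_free.
by split=> //; exact: interiorB.
Qed.

(** [lattice_point_unique] applied to [z0 + w], whose position relative to the apex
is [s + w]. *)
Lemma lattice_height_gt0 w : Zn w -> (forall i, -1 < dot (u i) w) -> w != 0 ->
  0 < dot h w.
Proof.
move=> wZ wu w0; rewrite ltNge; apply/negP => hw; case/eqP: w0.
have zw : z0 + w - a = s + w by rewrite addrAC.
suff : z0 + w = z0 by move=> /(canRL (addKr _)) ->; rewrite addNr.
apply: lattice_point_unique; first exact: integral_pointD.
  by move=> i; rewrite zw dotDr us; have := wu i; lra.
by rewrite zw dotDr hs; lra.
Qed.

Lemma K_ge0 : 0 <= K.
Proof.
have : `|s| <= K * dot h s by apply: u_norm => i; rewrite us.
by rewrite hs mulr1; apply: le_trans.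
Qed.

Lemma slab_bound x : (forall k, -2 <= dot (u k) x) -> dot h x <= 2 ->
  `|x| <= 4 * K + 2 * `|s|.
Proof.
have K0 := K_ge0; move=> xu xh; have /u_norm : forall i, 0 <= dot (u i) (x + 2 *: s).
  by move=> i; rewrite dotDr dotZr us; have := xu i; lra.
rewrite dotDr dotZr hs => xs.
have : K * (dot h x + 2 * 1) <= K * 4 by rewrite ler_wpM2l //; lra.
have := ler_normB (x + 2 *: s) (2 *: s).
by rewrite addrK normrZ ger0_norm //; lra.
Qed.

(** The gauge at a point [f] close to the apex measures heights almost exactly,
while it tolerates violations of the facet inequalities of order [eta]. *)
Lemma gauge_bounds eta f r rho : 0 < eta -> eta < 1 -> f = a + eta *: s ->
  gauge_function B f r < rho ->
  [/\ 0 < rho, forall k, - (eta * rho) <= dot (u k) r & dot h r <= (1 - eta) * rho].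
Proof.
move=> eta0 eta1 fE lt.
have fa : f - a = eta *: s by rewrite fE addrC addKr.
have fB : B° f.
  by apply: interiorB => [i|]; rewrite fa dotZr ?us ?hs mulr1.
have [rho0 /BP []] := gauge_lt B_convex fB lt.
have -> : f + rho^-1 *: r - a = eta *: s + rho^-1 *: r by rewrite addrAC fa.
move=> ru rh; split=> // [k|].
  have := ru k; rewrite dotDr !dotZr us mulr1 => H.
  have := mulr_ge0 (ltW rho0) H; rewrite mulrDr mulVKf ?gt_eqF //.
  by lra.
move: rh; rewrite dotDr !dotZr hs mulr1 -lerBrDl.
by rewrite ler_pdivrMl // mulrC.
Qed.

(** The integral points occurring below have norm at most twice this, uniformly in
[eps, eta <= 1]. *)
Definition radius (q : V) : R := 4 * K + 4 * `|s| + `|a| + 2 * `|q|.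

Lemma radius_ge (q : V) (t t' : R) : 0 <= t <= 1 -> 0 <= t' <= 1 ->
  [/\ `|t *: q| <= `|q|, `|t' *: s| <= `|s| & 0 <= 4 * K].
Proof.
have K0 := K_ge0; move=> /andP [t0 t1] /andP [t'0 t'1]; rewrite !normrZ !ger0_norm //.
by rewrite !ler_piMl // mulr_ge0.
Qed.

Lemma lattice_gap (rad : R) : exists2 e, 0 < e & forall w k, Zn w -> `|w| <= rad ->
  [/\ - e < dot (u k) w -> 0 <= dot (u k) w,
      0 < dot (u k) w -> e <= dot (u k) w &
      dot (u k) w < 1 + e -> dot (u k) w <= 1].
Proof.
have finW := finite_setX (@finite_integral R n rad) (@finite_finset _ [set: 'I_m]).
have [e1 e10 gap1] := finite_gap (fun wk => - dot (u wk.2) wk.1) finW.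
have [e2 e20 gap2] := finite_gap (fun wk => dot (u wk.2) wk.1) finW.
have [e3 e30 gap3] := finite_gap (fun wk => dot (u wk.2) wk.1 - 1) finW.
exists (Num.min e1 (Num.min e2 e3)); first by rewrite !lt_min e10 e20 e30.
move=> w k wZ wrad; have wk : ([set w | Zn w /\ `|w| <= rad] `*` setT) (w, k) by [].
have := gap1 _ wk; have := gap2 _ wk; have := gap3 _ wk.
rewrite /= subr_gt0 oppr_gt0 => H3 H2 H1; split.
- rewrite ltNge => H; rewrite leNgt; apply/negP => /H1 le1; move/negP: H; apply.
  by rewrite lerNr !ge_min le1.
- by move=> /H2 le2; rewrite !ge_min le2 orbT.
- rewrite ltNge => H; rewrite leNgt; apply/negP => /H3 le3; move/negP: H; apply.
  by rewrite -lerBrDl !ge_min le3 !orbT.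
Qed.

(** If one of these points were integral, then up to sign and a shift by [z0] it would
be an integral point on which [u i] is slightly negative or slightly more than 1,
against the gap. *)
Lemma apex_shift_nonintegral (e : R) (q : V) i (eps eta : R) :
  (forall w, Zn w -> `|w| <= radius q -> - e < dot (u i) w -> 0 <= dot (u i) w) ->
  (forall w, Zn w -> `|w| <= radius q -> dot (u i) w < 1 + e -> dot (u i) w <= 1) ->
  0 < eps <= 1 -> 0 < eta <= 1 -> dot (u i) q < 0 ->
  eta - 2 * (eps * dot (u i) q) < e ->
  let p := eps *: q - eta *: s in let p' := - (a + eps *: q) in
  [/\ ~ Zn p, ~ Zn p' & ~ Zn (p' - p)].
Proof.
move=> gap0 gap1 /andP [eps0 eps1] /andP [eta0 eta1] qi small p p'.
have eqi : eps * dot (u i) q < 0 by rewrite pmulr_rlt0.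
have [nq ns K4] := @radius_ge q eps eta
  (introT andP (conj (ltW eps0) eps1)) (introT andP (conj (ltW eta0) eta1)).
have na := normr_ge0 a; have nq0 := normr_ge0 q; have ns0 := normr_ge0 s.
split=> pZ.
- have /(gap0 _ pZ) : `|p| <= radius q.
    by apply: le_trans (ler_normB _ _) _; rewrite /radius; move: nq ns K4 na nq0 ns0; pure_lra.
  rewrite /p dotBr !dotZr us mulr1; move: small eqi eta0; pure_lra.
- have wE : z0 + p' = s - eps *: q by apply/colP => l; rewrite !mxE; ring.
  have wZ : Zn (s - eps *: q) by rewrite -wE; exact: integral_pointD.
  have /(gap1 _ wZ) : `|s - eps *: q| <= radius q.
    by apply: le_trans (ler_normB _ _) _; rewrite /radius; move: nq ns K4 na nq0 ns0; pure_lra.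
  rewrite dotBr !dotZr us; move: small eqi eta0; pure_lra.
- have wE : z0 + (p' - p) = s + eta *: s - 2 *: (eps *: q).
    by apply/colP => l; rewrite !mxE; ring.
  have wZ : Zn (s + eta *: s - 2 *: (eps *: q)) by rewrite -wE; exact: integral_pointD.
  have /(gap1 _ wZ) : `|s + eta *: s - 2 *: (eps *: q)| <= radius q.
    apply: le_trans (ler_normB _ _) _; rewrite [`|2 *: _|]normrZ ger0_norm //.
    apply: le_trans (lerD (ler_normD _ _) (lexx _)) _.
    by rewrite /radius; move: nq ns K4 na nq0 ns0; pure_lra.
  rewrite dotBr dotDr !dotZr us mulr1; move: small eqi eta0; pure_lra.
Qed.

(** For [f = a + eta *: s] near the apex, [unique_lifting_gauge_pair] gives for
the point [a + eps *: q] an integral translate [a + eps *: q + w] and an integral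
point [z] such that both this translate and its reflection [z + a - (a + eps *: q + w)]
lie in [B], up to errors of order [eta] and [tol]. *)
Lemma cover_near_apex (q : V) (eps eta tol : R) :
  0 < eps <= 1 -> 0 < eta <= 1 / 2 -> 0 < tol <= 1 ->
  (let p := eps *: q - eta *: s in let p' := - (a + eps *: q) in
   [/\ ~ Zn p, ~ Zn p' & ~ Zn (p' - p)]) ->
  exists w z, [/\ Zn w /\ `|w| <= radius q, Zn z /\ `|z| <= 2 * radius q,
    forall k, - eta < eps * dot (u k) q + dot (u k) w,
    forall k, - (2 * eta) < dot (u k) (z - a) - (eps * dot (u k) q + dot (u k) w) &
    dot h (z - a) < 1 + tol].
Proof.
move=> eps01 eta01 /andP [tol0 tol1] /=; set p := _ - _; set p' := - _ => -[pZ p'Z p'pZ].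
have /andP [eps0 eps1] := eps01; have /andP [eta0 eta2] := eta01.
have eta1 : eta < 1 by move: eta2; pure_lra.
have eta1' : 0 < 1 - eta by rewrite subr_gt0.
pose f := a + eta *: s.
have fa : f - a = eta *: s by rewrite /f addrC addKr.
have fB : B° f by apply: interiorB => [k|]; rewrite fa dotZr ?us ?hs mulr1.
have [nq ns K4] := @radius_ge q eps eta
  (introT andP (conj (ltW eps0) eps1)) (introT andP (conj (ltW eta0) (ltW eta1))).
have na := normr_ge0 a; have nq0 := normr_ge0 q; have ns0 := normr_ge0 s.
have B_bounded b : B b -> `|b - f| <= K + `|s|.
  move=> /BP [bu bh]; rewrite /f opprD addrA.
  apply: le_trans (ler_normB _ _) (lerD _ ns).
  by apply: le_trans (u_norm bu) _; rewrite -[leRHS]mulr1; apply: ler_wpM2l => //; exact: K_ge0.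
have pp' : p + p' = - f by apply/colP => l; rewrite !mxE; ring.
have [w [w' [wZ w'Z ww']]] := unique_lifting_gauge_pair B_convex fB B_free B_bounded
  (B_unique fB) pp' pZ p'Z p'pZ tol0.
have [rho [rho' [lt_rho lt_rho' rr]]] : exists rho rho',
    [/\ gauge_function B f (p + w) < rho, gauge_function B f (p' + w') < rho' &
        rho + rho' < 1 + tol].
  move: ww'; set g := gauge_function _ _ _; set g' := gauge_function _ _ _ => ww'.
  exists (g + (1 + tol - (g + g')) / 4), (g' + (1 + tol - (g + g')) / 4).
  by split; move: ww'; pure_lra.
have [rho0 ru rh] := gauge_bounds eta0 eta1 erefl lt_rho.
have [rho0' ru' rh'] := gauge_bounds eta0 eta1 erefl lt_rho'.
have rho2 : rho <= 2 by move: rr rho0' tol1; pure_lra.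
have rho2' : rho' <= 2 by move: rr rho0 tol1; pure_lra.
have er : eta * rho < eta * 2 by rewrite ltr_pM2l //; move: rr rho0' tol1; pure_lra.
have er' : eta * rho' < eta * 2 by rewrite ltr_pM2l //; move: rr rho0 tol1; pure_lra.
have h2 c : 0 < c -> c <= 2 -> (1 - eta) * c <= 2.
  by move=> c0 c2; rewrite mulrBl mul1r; have := mulr_gt0 eta0 c0; move: c2; pure_lra.
have rN : `|p + w| <= 4 * K + 2 * `|s|.
  apply: slab_bound => [k|]; last exact: le_trans rh (h2 _ rho0 rho2).
  by have := ru k; move: er eta2; pure_lra.
have rN' : `|p' + w'| <= 4 * K + 2 * `|s|.
  apply: slab_bound => [k|]; last exact: le_trans rh' (h2 _ rho0' rho2').
  by have := ru' k; move: er' eta2; pure_lra.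
have wrad : `|w| <= radius q.
  have -> : w = p + w - eps *: q + eta *: s by apply/colP => l; rewrite !mxE; ring.
  apply: le_trans (ler_normD _ _) _; apply: le_trans (lerD (ler_normB _ _) (lexx _)) _.
  by rewrite /radius; move: rN nq ns K4 na nq0 ns0; pure_lra.
have w'rad : `|w'| <= radius q.
  have -> : w' = p' + w' + a + eps *: q by apply/colP => l; rewrite !mxE; ring.
  apply: le_trans (ler_normD _ _) _; apply: le_trans (lerD (ler_normD _ _) (lexx _)) _.
  by rewrite /radius; move: rN' nq ns K4 na nq0 ns0; pure_lra.
have rk k : dot (u k) (p + w) = eps * dot (u k) q - eta + dot (u k) w.
  by rewrite dotDr dotBr !dotZr us mulr1.
have zaE : w + w' - a = (p + w) + (p' + w') + eta *: s.
  by apply/colP => l; rewrite !mxE; ring.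
exists w, (w + w'); split; rewrite ?zaE //.
- split; first exact: integral_pointD.
  by apply: le_trans (ler_normD _ _) _; move: wrad w'rad; pure_lra.
- by move=> k; have := ru k; rewrite rk; move: er; pure_lra.
- move=> k; have := ru' k; rewrite [dot (u k) (p + w + (p' + w') + _)]dotDr.
  rewrite [dot (u k) (p + w + (p' + w'))]dotDr dotZr us mulr1 rk.
  by move: er'; pure_lra.
- rewrite [dot h (p + w + (p' + w') + _)]dotDr [dot h (p + w + (p' + w'))]dotDr dotZr hs mulr1.
  have : (1 - eta) * (rho + rho') < (1 - eta) * (1 + tol) by rewrite ltr_pM2l.
  by have := mulr_gt0 eta0 tol0; move: rh rh'; pure_lra.
Qed.

(** Let [q] violate only the [i]-th facet inequality. The point [a + eps *: q] lies
just outside the cone, beyond facet [i], and by [cover_near_apex] some integral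
[w] moves it back into the intersection of the cone with its reflection in the
midpoint of [a] and [z]. All facet functionals are positive at [z - a], so [z = z0];
the bounds [0 <= dot (u k) (eps *: q + w) <= 1] then give the claim for [k != i]
and [0 < dot (u i) w <= 1], up to errors that the gaps between the values of the
functionals at integral points absorb. If [dot (u i) w < 1], both [w] and [- w] would have
positive height. *)
Lemma facet_lattice_vector i : exists y, [/\ Zn y, dot (u i) y = 1 &
  forall k, k != i -> 0 <= dot (u k) y < 1].
Proof.
have [q [qi qk]] : exists q, dot (u i) q < 0 /\ forall k, k != i -> 0 < dot (u k) q.
  (* A small multiple of [s] makes the remaining inequalities strict. *)
  have [q0 q0i q0k] := u_facet i.
  exists (q0 - (dot (u i) q0 / 2) *: s); split=> [|k ki].
    by rewrite dotBr dotZr us; lra.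
  by rewrite dotBr dotZr us; have := q0k k ki; lra.
have [e e0 gap] := lattice_gap (radius q).
have [e4 e40 gap4] := finite_gap (fun z => dot h (z - a) - 1)
  (@finite_integral R n (2 * radius q)).
have [c c0 qc] := finite_gap (fun k => `|dot (u k) q|) (@finite_finset _ [set: 'I_m]).
(* [c <= `|dot (u k) q| <= C] for all [k]; first [eps] is chosen small against the
   gap [e], then [eta] against both [eps] and [e]. *)
pose C := \sum_k `|dot (u k) q| + 1.
have C0 : 0 < C by rewrite ltr_wpDl // sumr_ge0.
have qC k : `|dot (u k) q| <= C.
  by rewrite /C (bigD1 k) //= -addrA lerDl addr_ge0 // sumr_ge0.
have qic : c <= - dot (u i) q by rewrite -ltr0_norm // qc // normr_gt0 lt_eqF.
have qkc k : k != i -> c <= dot (u k) q.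
  by move=> ki; rewrite -(gtr0_norm (qk k ki)) qc // normr_gt0 gt_eqF // qk.
pose eps := Num.min 1 (e / 4 / C).
have eps0 : 0 < eps by rewrite lt_min ltr01 !divr_gt0.
have eps1 : eps <= 1 by rewrite ge_min lexx.
have epsC : eps * C <= e / 4 by rewrite -ler_pdivlMr // ge_min lexx orbT.
pose eta := Num.min (1 / 2) (Num.min (eps * c / 4) (e / 16)).
have epsc : 0 < eps * c by exact: mulr_gt0.
have eta0 : 0 < eta by rewrite !lt_min !divr_gt0.
have eta2 : eta <= 1 / 2 by rewrite ge_min lexx.
have etac : eta <= eps * c / 4 by rewrite !ge_min lexx !orbT.
have etae : eta <= e / 16 by rewrite !ge_min lexx !orbT.
have qe k : - (e / 4) <= eps * dot (u k) q <= e / 4.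
  rewrite -ler_norml normrM gtr0_norm //; apply: le_trans epsC.
  by rewrite ler_wpM2l // ltW.
have qike : eps * c <= - (eps * dot (u i) q) by rewrite -mulrN ler_wpM2l // ltW.
have qkke k : k != i -> eps * c <= eps * dot (u k) q.
  by move=> ki; rewrite ler_wpM2l ?qkc // ltW.
have tol01 : 0 < Num.min 1 e4 <= 1 by rewrite lt_min ltr01 e40 ge_min lexx.
have nonint : let p := eps *: q - eta *: s in let p' := - (a + eps *: q) in
    [/\ ~ Zn p, ~ Zn p' & ~ Zn (p' - p)].
  apply: (apex_shift_nonintegral (e := e) (i := i)) => //.
  - by move=> w wZ wr; have [] := gap w i wZ wr.
  - by move=> w wZ wr; have [] := gap w i wZ wr.
  - by rewrite eps0.
  - by rewrite eta0; move: eta2; pure_lra.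
  - by have /andP [+ _] := qe i; move: etae e0; pure_lra.
have [||w [z [[wZ wr] [zZ zr] ruw rvz hz]]] := @cover_near_apex q eps eta _ _ _ tol01 nonint.
- by rewrite eps0.
- by rewrite eta0.
have wk k : k != i -> 0 <= dot (u k) w.
  move=> ki; have [+ _ _] := gap w k wZ wr; apply.
  by have := ruw k; have /andP [_] := qe k; move: etae e0; pure_lra.
have wi : 0 < dot (u i) w by have := ruw i; move: qike etac epsc; pure_lra.
have wie : e <= dot (u i) w by have [_ + _] := gap w i wZ wr; apply.
have zE : z = z0.
  apply: lattice_point_unique => // [k|].
    have := rvz k; have [->|ki] := eqVneq k i.
      by have /andP [+ _] := qe i; move: wie etae e0; pure_lra.
    by have := wk k ki; have := qkke k ki; move: etac epsc; pure_lra.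
  rewrite leNgt -subr_gt0; apply/negP => /(gap4 z (conj zZ zr)).
  have : Num.min 1 e4 <= e4 by rewrite ge_min lexx orbT.
  by move: hz; pure_lra.
rewrite zE in rvz.
have wk1 k : k != i -> dot (u k) w < 1.
  by move=> ki; have := rvz k; rewrite us; have := qkke k ki; move: etac epsc; pure_lra.
have wi1 : dot (u i) w <= 1.
  have [_ _ +] := gap w i wZ wr; apply.
  by have := rvz i; rewrite us; have /andP [+ _] := qe i; move: etae e0; pure_lra.
exists w; split=> // [|k ki]; last by rewrite wk // wk1.
apply/eqP; rewrite eq_le wi1 leNgt; apply/negP => lt1.
have w0 : w != 0 by apply/eqP => w0; rewrite w0 dot0r ltxx in wi.
have hw : 0 < dot h w.
  apply: lattice_height_gt0 => // k; have [->|ki] := eqVneq k i.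
    by move: wi; pure_lra.
  by have := wk k ki; pure_lra.
suff : 0 < dot h (- w) by rewrite dotNr oppr_gt0 ltNge ltW.
apply: lattice_height_gt0; rewrite ?oppr_eq0 //; first exact: integral_pointN.
move=> k; rewrite dotNr ltrN2; have [->//|ki] := eqVneq k i; exact: wk1.
Qed.

(** For the vectors [y i] of [facet_lattice_vector], [dot (u k) (y i) > 0] with
[k != i] implies that all facet functionals exceed -1 on [y i - y k], so that [y i]
is higher than [y k]. Ordered by height, the matrix of the [dot (u k) (y i)] is
therefore unitriangular. *)
Lemma facet_functionals_free (c : 'I_m -> R) :
  (forall x, \sum_i c i * dot (u i) x = 0) -> forall i, c i = 0.
Proof.
move=> cu i0; apply/eqP/negPn/negP => ci0.
have [y Hy] := choice facet_lattice_vector.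
(* At the lowest [y i] in the support of [c] only the [i]-th term survives. *)
pose i := [arg min_(j < i0 | c j != 0) dot h (y j)]%O.
have [ci ymin] : c i != 0 /\ forall k, c k != 0 -> dot h (y i) <= dot h (y k).
  by rewrite /i; case: arg_minP.
have [yiZ yii yik] := Hy i.
have := cu (y i); rewrite (bigD1 i) //= yii mulr1 big1 => [|k ki].
  by rewrite addr0 => /eqP; rewrite (negbTE ci).
have [->|ck] := eqVneq (c k) 0; first by rewrite mul0r.
have [ykZ ykk yki] := Hy k.
have [->|yk0] := eqVneq (dot (u k) (y i)) 0; first by rewrite mulr0.
have /andP [yk_ge0 yk_lt1] := yik k ki.
have : 0 < dot h (y i - y k); last first.
  by rewrite dotBr subr_gt0 ltNge ymin.
apply: lattice_height_gt0; first exact: integral_pointB.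
  move=> l; rewrite dotBr; have [->|lk] := eqVneq l k.
    by rewrite ykk ltrBrDr addNr lt_neqAle eq_sym yk0.
  have /andP [_ lt1] := yki l lk.
  have [li|li] := eqVneq l i; first by rewrite li in lt1 *; rewrite yii; lra.
  by have /andP [? _] := yik l li; lra.
apply/eqP => /subr0_eq yE; have /andP [] := yik k ki.
by rewrite yE ykk ltxx.
Qed.

(** Both [x] and [- x] lie in the cone, where the height controls the norm. *)
Lemma cone_eq0 x : (forall i, dot (u i) x = 0) -> x = 0.
Proof.
move=> ux; apply/eqP; rewrite -normr_le0.
have : `|x| <= K * dot h x by apply: u_norm => i; rewrite ux.
have : `|- x| <= K * dot h (- x) by apply: u_norm => i; rewrite dotNr ux oppr0.
by rewrite normrN dotNr mulrN; lra.
Qed.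

(** Linear independence gives a right inverse of the matrix of facet functionals;
its columns span the extreme rays of the cone. *)
Lemma dual_basis : exists e : 'I_m -> V, forall i j, dot (u i) (e j) = (i == j)%:R.
Proof.
pose U : 'M[R]_(m, n) := \matrix_(i, j) u i 0 j.
have Ux k (X : 'M[R]_(n, k)) i j : (U *m X) i j = dot (u i) (col j X).
  by rewrite /dot !mxE; apply: eq_bigr => l _; rewrite !mxE.
have : row_free U.
  apply/inj_row_free => v vU; apply/rowP => i; rewrite mxE.
  apply: (facet_functionals_free (c := fun i => v 0 i)) => x.
  have : (v *m U *m x) 0 0 = 0 by rewrite vU mul0mx mxE.
  rewrite -mulmxA mxE => vx; transitivity (\sum_j v 0 j * (U *m x) j 0) => //.
  apply: eq_bigr => j _; rewrite Ux.
  by congr (_ * dot _ _); apply/colP => l; rewrite !mxE.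
move=> /row_freeP [E UE]; exists (fun j => col j E) => i j.
by rewrite -Ux UE mxE.
Qed.

Lemma pyramid_simplex : simplex B.
Proof.
have [e ue] := dual_basis.
have e_cone j i : 0 <= dot (u i) (e j) by rewrite ue ler0n.
have he j : 0 < dot h (e j).
  rewrite ltNge; apply/negP => hj.
  have : `|e j| <= 0.
    by apply: le_trans (u_norm (e_cone j)) _; rewrite mulr_ge0_le0 // K_ge0.
  rewrite normr_le0 => /eqP ej0; have := ue j j.
  by rewrite ej0 dot0r eqxx => /eqP; rewrite eq_sym oner_eq0.
(* The extreme rays meet the base in the vertices [a + r j]. *)
pose r j := (dot h (e j))^-1 *: e j.
have hr j : dot h (r j) = 1 by rewrite dotZr mulVf // gt_eqF.
pose v (i : 'I_m.+1) := if unlift ord0 i is Some j then a + r j else a.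
have v0 : v ord0 = a by rewrite /v unlift_none.
have vS j : v (lift ord0 j) = a + r j by rewrite /v liftK.
have coord x : x = \sum_j (dot (u j) x * dot h (e j)) *: r j.
  apply/eqP; rewrite -subr_eq0; apply/eqP; apply: cone_eq0 => i.
  rewrite dotBr dot_sumr (bigD1 i) //= big1 => [|j ji].
    rewrite addr0 /r scalerA mulfK ?gt_eqF //.
    by rewrite dotZr ue eqxx mulr1 subrr.
  rewrite /r scalerA mulfK ?gt_eqF //.
  by rewrite dotZr ue eq_sym (negbTE ji) mulr0.
exists m, v; split=> [c|].
  rewrite !big_ord_recl v0 => cv c1.
  have cS j : c (lift ord0 j) = 0.
    have : dot (u j) (\sum_k c (lift ord0 k) *: r k) = 0.
      have -> : \sum_k c (lift ord0 k) *: r k =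
          c ord0 *: a + \sum_k c (lift ord0 k) *: v (lift ord0 k) -
          (c ord0 + \sum_k c (lift ord0 k)) *: a.
        rewrite scalerDl opprD addrACA subrr add0r scaler_suml -sumrB.
        by apply: eq_bigr => k _; rewrite vS scalerDr addrC addKr.
      by rewrite cv c1 scale0r subrr dot0r.
    rewrite dot_sumr (bigD1 j) //= big1 => [|k kj].
      rewrite addr0 /r !dotZr ue eqxx mulr1 => /eqP.
      by rewrite mulf_eq0 invr_eq0 [_ (e j) == 0]gt_eqF // orbF => /eqP.
    by rewrite /r !dotZr ue eq_sym (negbTE kj) !mulr0.
  move: c1; rewrite big1 => [|j _]; last exact: cS.
  by rewrite addr0 => c0 i; case: (unliftP ord0 i) => [j ->|->].
apply/seteqP; split=> [x /BP [xu xh]|]; last first.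
  apply: smallest_sub => [|_ [i _ <-]]; first exact: B_convex.
  apply/BP.
  case: (unliftP ord0 i) => [j ->|->].
    rewrite vS addrC addKr hr; split=> // k.
    by rewrite dotZr mulr_ge0 // invr_ge0 ltW.
  by rewrite v0 subrr dot0r; split=> // k; rewrite dot0r.
rewrite -(subrKC a x); have Xv i : conv_hull (range v) (v i).
  by apply: sub_gen_smallest; exists i.
apply: (@cone_truncation _ _ _ _ [seq r j | j <- enum 'I_m] h) => //.
- exact: conv_hull_convex.
- by rewrite -v0.
- by move=> _ /mapP [j _ ->].
- by move=> _ /mapP [j _ ->]; rewrite -vS.
- rewrite [x - a]coord; apply: cone_sum => i; first by rewrite mulr_ge0 // ltW.
  by apply/mapP; exists i; rewrite ?mem_enum.
Qed.

End UniqueLiftingPyramid.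

Theorem theorem6p3 (R : realType) (n : nat) (B : set 'cV[R]_n)
    (B_polytope : polytope B) (B_mlf : maximal_lattice_free B)
    (B_unique : unique_lifting B)
    (B_pyramid : exists (P0 : set 'cV[R]_n) (a : 'cV[R]_n),
        pyramid B P0 a /\ exists! z : 'cV[R]_n, (relint P0 `&` @integral_point R n) z) :
  simplex B.
Proof.
have [P0 [a [Bpyr [z0 [[z0_relint z0Z] z0_unique]]]]] := B_pyramid.
have [[B_full _ _ B_free] _] := B_mlf.
have [m [u [h [K [BP [us hs] u_facet u_norm u_relint]]]]] :=
  pyramid_description Bpyr B_full z0_relint.
apply: (pyramid_simplex BP us hs u_facet u_norm u_relint B_free z0Z _ B_unique).
by move=> z z_relint zZ; apply: z0_unique.
Qed.
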